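(* Consider Activated Random Walks on $\mathbb{Z}^d$ with sleep rate $\lambda\in(0,\infty)$. For any jump distribution $p(\cdot)$ in any dimension $d\geqslant1$, $\zeta_c\geqslant\frac{\lambda}{1+\lambda}$.
   Context: Activated Random Walk (ARW) on $\mathbb{Z}^d$. Fix $d\geqslant1$, a sleep rate $0<\lambda<\infty$ and a jump distribution $p(\cdot)$, i.e. a probability distribution on $\mathbb{Z}^d$ supported on the nearest neighbors $\{\pm e_1,\dots,\pm e_d\}$ of the origin $\boldsymbol{0}$ and whose support generates the group $\mathbb{Z}^d$. Let $\mathbb{N}_0=\{0,1,2,\dots\}$ and $\mathbb{N}_{\mathfrak{s}}=\mathbb{N}_0\cup\{\mathfrak{s}\}$, ordered by $0<\mathfrak{s}<1<2<\cdots$, with $|\mathfrak{s}|=1$, $|n|=n$, $\mathfrak{s}+1=2$, $1\cdot\mathfrak{s}=\mathfrak{s}$ and $n\cdot\mathfrak{s}=n$ for $n\geqslant2$. A configuration is $\eta\in(\mathbb{N}_{\mathfrak{s}})^{\mathbb{Z}^d}$: site $x$ contains $\eta(x)$ active particles if $\eta(x)\in\mathbb{N}_0$ and one sleeping particle if $\eta(x)=\mathfrak{s}$. Evolution: at each site $x$ a clock rings at rate $(1+\lambda)\,\eta_t(x)\,\mathbf{1}_{\{\eta_t(x)\neq\mathfrak{s}\}}$. When it rings, with probability $\frac{\lambda}{1+\lambda}$ the value $\eta(x)$ is replaced by $\eta(x)\cdot\mathfrak{s}$; otherwise, with probability $\frac{p(y-x)}{1+\lambda}$ for each $y$, $\eta(x)$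 is replaced by $\eta(x)-1$ and $\eta(y)$ by $\eta(y)+1$. For a translation-ergodic distribution $\nu$ on $(\mathbb{N}_{\mathfrak{s}})^{\mathbb{Z}^d}$ with finite density $\int|\eta(\boldsymbol{0})|\nu(\mathrm{d}\eta)<\infty$ there is a process $(\eta_t)_{t\geqslant0}$ with these rates and $\eta_0\sim\nu$; its law $\mathbf{P}^{\nu}$ is characterized by $\mathbf{P}^{\nu}(\mathcal{A})=\lim_{V\uparrow\mathbb{Z}^d}\mathbf{P}^{\nu}_V(\mathcal{A})$ for every event $\mathcal{A}$ determined by $(\eta_s(x))_{x\in B,\,s\in[0,t]}$ with $B$ finite and $t<\infty$, where $\mathbf{P}^{\nu}_V$ is the law of the (finite) system started from $\eta_0\cdot\mathbf{1}_V$, $V$ finite. The system stays active if, for each site, there are arbitrarily large times at which the site has at least one active particle. It fixates if, for each site, there is a (random) time after which the site is always either vacant or occupied by exactly one sleeping particle. Critical density: given $d$, $p(\cdot)$, $\lambda$, the critical density $\zeta_c$ is the unique number such that, for every translation-ergodic distribution $\nu$ supported on $(\mathbb{N}_0)^{\mathbb{Z}^d}$ (all particles initially active) with finite density $\zeta$, $\mathbf{P}^\nu(\text{system stays active})$ equals $0$ if $\zeta<\zeta_c$ and $1$ if $\zeta>\zeta_c$ (existence of such a number is a known theorem). *)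

(* Defs.v *)
From HB Require Import structures.
From mathcomp Require Import all_boot all_order all_algebra finmap.
From mathcomp Require Import all_classical all_reals all_analysis.
From mathcomp Require Import measurable_realfun summability.
Import Order.TTheory GRing.Theory Num.Theory.
Import numFieldNormedType.Exports.

Set Implicit Arguments.
Unset Strict Implicit.
Unset Printing Implicit Defensive.

Local Open Scope classical_set_scope.
Local Open Scope ring_scope.

Definition site (d : nat) := 'rV[int]_d.

Definition unit_site {d : nat} (i : 'I_d) : site d := delta_mx 0 i.

(* N_s = N_0 u {s}: [Active n] is n, [Sleeping] is s. *)
Inductive occ : Type := Active of nat | Sleeping.

HB.instance Definition _ := gen_eqMixin occ.
HB.instance Definition _ := gen_choiceMixin occ.
HB.instance Definition _ := isPointed.Build occ (Active 0%N).

(* |n| = n and |s| = 1 *)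
Definition occ_abs (a : occ) : nat := if a is Active n then n else 1%N.

(* a * 1_{a <> s} *)
Definition occ_active (a : occ) : nat := if a is Active n then n else 0%N.

(* s + 1 = 2 *)
Definition occ_succ (a : occ) : occ :=
  if a is Active n then Active n.+1 else Active 2%N.

(* a - 1; only ever used at a site with at least one active particle *)
Definition occ_pred (a : occ) : occ :=
  if a is Active n then Active n.-1 else Sleeping.

(* a * s, where 1 * s = s and n * s = n for n >= 2; the values at 0 and s are
   never used since the clock of such a site does not ring *)
Definition occ_sleep (a : occ) : occ :=
  if a is Active 1%N then Sleeping else a.

(* The sigma-algebra on configurations is the product one, each coordinate
   ranging over the discrete countable set [occ]. *)
Definition config_cylinders (d : nat) : set (set (site d -> occ)) :=
  [set C | exists (x : site d) (a : occ), C = [set eta | eta x = a]].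

Definition config (d : nat) := g_sigma_algebraType (@config_cylinders d).

Definition shift {d : nat} (z : site d) (eta : config d) : config d :=
  fun x => eta (x + z).

(* eta * 1_V *)
Definition restrict_config {d : nat} (V : {fset site d}) (eta : config d) :
    config d :=
  fun x => if x \in V then eta x else Active 0%N.

Definition sleep_at {d : nat} (x : site d) (eta : config d) : config d :=
  fun z => if z == x then occ_sleep (eta x) else eta z.

Definition jump {d : nat} (x y : site d) (eta : config d) : config d :=
  fun z => if z == x then occ_pred (eta x)
           else if z == y then occ_succ (eta y) else eta z.

Definition jump_distribution {R : realType} {d : nat} (p : site d -> R) :
    Prop :=
  [/\ forall z, 0 <= p z,
      forall z, p z != 0 -> exists i, z = unit_site i \/ z = - unit_site i,
      \sum_(z \in [set: site d]) p z = 1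
    & forall G : {pred site d}, zmod_closed G ->
        (forall z, p z != 0 -> z \in G) -> forall z, z \in G].

Definition translation_ergodic {R : realType} {d : nat}
    (nu : probability (config d) R) : Prop :=
  (forall (z : site d) (A : set (config d)), measurable A ->
     nu (shift z @^-1` A) = nu A) /\
  (forall A : set (config d), measurable A ->
     (forall z : site d, shift z @^-1` A = A) -> nu A = 0%E \/ nu A = 1%E).

Definition density {R : realType} {d : nat} (nu : probability (config d) R) :
    \bar R :=
  (\int[nu]_eta ((occ_abs (eta 0))%:R)%:E)%E.

Definition all_active {R : realType} {d : nat}
    (nu : probability (config d) R) : Prop :=
  nu [set eta | forall x, eta x <> Sleeping] = 1%E.

(* Each coordinate is right-continuous with left limits for the discrete
   topology on [occ]. *)
Definition cadlag {R : realType} {d : nat} (w : R -> site d -> occ) : Prop :=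
  forall x,
    (forall t, 0 <= t -> \forall s \near t^'+, w s x = w t x) /\
    (forall t, 0 < t -> exists a, \forall s \near t^'-, w s x = a).

(* Only the values at times t >= 0 matter: the sigma-algebra below does not see
   negative times. *)
Record trajectory (R : realType) (d : nat) := Trajectory {
  trajectory_fun :> R -> site d -> occ ;
  trajectory_cadlag : cadlag trajectory_fun }.

Lemma cadlag_empty (R : realType) (d : nat) :
  cadlag (fun (_ : R) (_ : site d) => Active 0%N).
Proof.
move=> x; split=> [t _|t _]; last exists (Active 0%N).
  exact: filterE.
exact: filterE.
Qed.

HB.instance Definition _ R d := gen_eqMixin (trajectory R d).
HB.instance Definition _ R d := gen_choiceMixin (trajectory R d).
HB.instance Definition _ R d :=
  isPointed.Build (trajectory R d) (Trajectory (@cadlag_empty R d)).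

Definition path_cylinders (R : realType) (d : nat) :
    set (set (trajectory R d)) :=
  [set C | exists (t : R) (x : site d) (a : occ), 0 <= t /\ C = [set w : trajectory R d | w t x = a]].

Definition paths (R : realType) (d : nat) :=
  g_sigma_algebraType (@path_cylinders R d).

(* A is determined by (eta_s(x)), x in B, s in [0, t]. *)
Definition window_event {R : realType} {d : nat} (B : {fset site d}) (t : R)
    (A : set (paths R d)) : Prop :=
  <<s [set C : set (trajectory R d) | exists (s : R) (x : site d) (a : occ),
         [/\ 0 <= s <= t, x \in B & C = [set w : trajectory R d | w s x = a]] ] >> A.

Definition stays_active {R : realType} {d : nat} : set (paths R d) :=
  [set w | forall (x : site d) (T : R),
     exists t : R, [/\ 0 <= t, T <= t & (0 < occ_active (w t x))%N]].

Section Dynamics.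
Context {R : realType} {d : nat} (lambda : R) (p : site d -> R).

Definition clock_rate (eta : config d) (x : site d) : R :=
  (1 + lambda) * (occ_active (eta x))%:R.

(* Total clock rate; only meaningful for finitely many active particles. *)
Definition total_rate (eta : config d) : R :=
  \sum_(x \in [set: site d]) clock_rate eta x.

(* Probability that a ring of the clock at x turns eta into eta'. *)
Definition ring_update (x : site d) (eta eta' : config d) : R :=
  lambda / (1 + lambda) * `[< eta' = sleep_at x eta >]%:R +
  \sum_(y \in [set: site d])
    p (y - x) / (1 + lambda) * `[< eta' = jump x y eta >]%:R.

(* Transition probabilities of the configuration from one clock ring to the
   next (the transition may be void); configurations without active particles
   are absorbing. *)
Definition ring_kernel (eta eta' : config d) : R :=
  if total_rate eta == 0 then `[< eta' = eta >]%:R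
  else \sum_(x \in [set: site d])
         clock_rate eta x / total_rate eta * ring_update x eta eta'.

(* Q is the law of the continuous-time Markov chain with the above rates,
   started from eta_0 * 1_V with eta_0 ~ nu, through its jump-chain and
   holding-time description: Y n is the configuration after n clock rings and
   H n the time it lasts, namely, given the successive configurations, an
   independent exponential time of parameter [total_rate (Y n)] (infinite when
   this rate is 0).  Almost surely \sum_i H i = +oo because the number of
   particles is finite and conserved. *)
Definition finite_system_law (nu : probability (config d) R)
    (V : {fset site d}) (Q : probability (paths R d) R) : Prop :=
  exists (disp : measure_display) (Omega : measurableType disp)
    (Pr : probability Omega R)
    (Y : nat -> Omega -> config d) (H : nat -> Omega -> \bar R)
    (X : Omega -> paths R d),
  [/\ (forall n, measurable_fun [set: Omega] (Y n)) /\
      (forall n, measurable_fun [set: Omega] (H n)) /\ measurable_fun [set: Omega] X,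
      forall (n : nat) (c : nat -> config d) (t : nat -> R),
        (forall i, 0 <= t i) ->
        Pr [set w | (forall i, (i <= n)%N -> Y i w = c i) /\
                    (forall i, (i < n)%N -> ((t i)%:E < H i w)%E)] =
        (nu [set eta | restrict_config V eta = c 0%N] *
         (\prod_(i < n) (ring_kernel (c i) (c i.+1) *
                         expR (- (total_rate (c i) * t i))))%:E)%E,
      forall (w : Omega) (n : nat) (t : R), 0 <= t ->
        (\sum_(i < n) H i w <= t%:E)%E -> (t%:E < \sum_(i < n.+1) H i w)%E ->
        X w t = Y n w
    & forall A, measurable A -> Q A = Pr (X @^-1` A)].

(* P is the law P^nu: P(A) = lim_V P_V^nu(A) for every event A determined by a
   finite space-time window, the limit being along the finite sets V directed
   by inclusion. *)
Definition ARW_law (nu : probability (config d) R)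
    (P : probability (paths R d) R) : Prop :=
  exists2 Q : {fset site d} -> probability (paths R d) R,
    forall V, finite_system_law nu V (Q V) &
    forall (B : {fset site d}) (t : R) (A : set (paths R d)),
      window_event B t A -> Q V A @[V --> totally] --> P A.

End Dynamics.

Definition critical_density {R : realType} {d : nat}
    (P : probability (config d) R -> probability (paths R d) R) (zetac : R) :
    Prop :=
  forall (nu : probability (config d) R) (zeta : R),
    translation_ergodic nu -> all_active nu -> density nu = zeta%:E ->
    (zeta < zetac -> P nu stays_active = 0%E) /\
    (zetac < zeta -> P nu stays_active = 1%E).

(* Main.v *)
Require Import Defs.
From HB Require Import structures.
From mathcomp Require Import all_boot all_order all_algebra finmap.
From mathcomp Require Import all_classical all_reals all_analysis.
From mathcomp Require Import measurable_realfun summability.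
From mathcomp Require Import ring lra zify.
Import Order.TTheory GRing.Theory Num.Theory.
Local Open Scope ring_scope.

Set Implicit Arguments.
Unset Strict Implicit.
Unset Printing Implicit Defensive.

Local Open Scope classical_set_scope.

(** Write theta = lambda / (1 + lambda).  In a finite system the law of the
    final configuration does not depend on the order of topplings.  Toppling [x]
    only when every other site is stable and [x] holds a lone particle, one sees
    that once [x] has been active it is occupied in the final configuration with
    probability at least theta; as particles are conserved, a system of N
    particles activates at most N / theta sites on average.  Start it from a
    spatially ergodic configuration of density zeta < theta restricted to a
    large box: averaging over the bulk, some site is ever active with
    probability at most zeta / theta + o(1) < 1, and re-centring the box at this
    site yields arbitrarily large windows around the origin with that bound,
    which passes to the infinite-volume limit.  So such a system does not stay
    active almost surely.  Initial configurations that are uniform over the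
    translates of a periodic one suffice, since they realize a dense set of
    densities. *)

(** * Active sites, toppling instructions and their commutation *)

Definition active {d : nat} (eta : config d) (x : site d) : bool :=
  (0 < occ_active (eta x))%N.

Definition stable {d : nat} (eta : config d) : bool :=
  `[< forall x, ~~ active eta x >].

Definition some_active {d : nat} (eta : config d) : site d :=
  xget 0 [set x | active eta x].

Definition occupied {d : nat} (x : site d) (eta : config d) : bool :=
  (0 < occ_abs (eta x))%N.

Definition neighbours (d : nat) : seq (site d) :=
  undup ([seq unit_site i | i <- enum 'I_d] ++
         [seq - unit_site i | i <- enum 'I_d]).

(* [None] is the sleep instruction, [Some z] a jump by [z]. *)
Definition instructions (d : nat) : seq (option (site d)) :=
  None :: map Some (neighbours d).

Definition act {d : nat} (x : site d) (i : option (site d)) (eta : config d) :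
    config d :=
  if i is Some z then jump x (x + z) eta else sleep_at x eta.

Lemma unit_site_neq0 (d : nat) (i : 'I_d) : unit_site i != 0.
Proof.
apply/eqP => /matrixP/(_ 0 i); rewrite !mxE !eqxx /=; exact/eqP.
Qed.

Lemma mem_neighbours (d : nat) (z : site d) :
  reflect (exists i, z = unit_site i \/ z = - unit_site i)
          (z \in neighbours d).
Proof.
rewrite mem_undup mem_cat; apply: (iffP orP) => [[]/mapP[i _ ->]|[i [->|->]]].
- by exists i; left.
- by exists i; right.
- by left; rewrite map_f ?mem_enum.
- by right; rewrite (map_f (fun i => - unit_site i)) ?mem_enum.
Qed.

Lemma neighbours_neq0 (d : nat) (z : site d) : z \in neighbours d -> z != 0.
Proof.
by case/mem_neighbours => i [->|->]; rewrite ?oppr_eq0 unit_site_neq0.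
Qed.

Lemma uniq_instructions (d : nat) : uniq (instructions d).
Proof.
rewrite /= map_inj_uniq ?undup_uniq ?andbT; last by move=> ? ? [].
by apply/mapP => -[].
Qed.

Lemma Some_instructions (d : nat) (z : site d) :
  (Some z \in instructions d) = (z \in neighbours d).
Proof. by rewrite inE /= mem_map // => ? ? []. Qed.

Lemma occ_activeP (a : occ) :
  reflect (exists n, a = Active n.+1) (0 < occ_active a)%N.
Proof.
case: a => [[|n]|] /=; constructor; [by case|by exists n|by case].
Qed.

Lemma activeP (d : nat) (eta : config d) (x : site d) :
  reflect (exists n, eta x = Active n.+1) (active eta x).
Proof. exact: occ_activeP. Qed.

Lemma active_some_active (d : nat) (eta : config d) :
  ~~ stable eta -> active eta (some_active eta).
Proof.
move=> /asboolPn/existsNP[x /negP]; rewrite negbK => ax.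
exact: (@xgetI _ 0 [set x | active eta x] x).
Qed.

Lemma active_nstable (d : nat) (eta : config d) (x : site d) :
  active eta x -> ~~ stable eta.
Proof. by move=> ax; apply/asboolPn => /(_ x)/negP. Qed.

Lemma stable_nactive (d : nat) (eta : config d) (x : site d) :
  stable eta -> ~~ active eta x.
Proof. by move=> /asboolP. Qed.

Lemma jumpE (d : nat) (x y : site d) (eta : config d) (t : site d) :
  jump x y eta t = if t == x then occ_pred (eta t)
                   else if t == y then occ_succ (eta t) else eta t.
Proof. by rewrite /jump; case: eqP => [->//|_]; case: eqP => [->|]. Qed.

Lemma sleep_atE (d : nat) (x : site d) (eta : config d) (t : site d) :
  sleep_at x eta t = if t == x then occ_sleep (eta t) else eta t.
Proof. by rewrite /sleep_at; case: eqP => [->|]. Qed.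

Lemma active_act (d : nat) (eta : config d) (x y : site d) i :
  y != x -> active eta x -> active (act y i eta) x.
Proof.
rewrite eq_sym => /negbTE xy /activeP[n ex]; apply/activeP.
case: i => [z|] /=; rewrite ?jumpE ?sleep_atE xy ex; last by exists n.
by case: ifP => _; [exists n.+1|exists n].
Qed.

(** The delicate case is a lone particle told to sleep at a site that also receives a particle.
    Sleeping first gives s + 1 = 2, receiving first gives 2 * s = 2, so the two orders agree. *)
Lemma act_comm (d : nat) (eta : config d) (x y : site d) i j :
  i \in instructions d -> j \in instructions d -> y != x ->
  active eta x -> active eta y ->
  act x i (act y j eta) = act y j (act x i eta).
Proof.
move=> im jm yx /activeP[n ex] /activeP[m ey].
have nb a z : Some z \in instructions d -> (a == a + z) = false.
  rewrite Some_instructions => /neighbours_neq0 z0.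
  by rewrite eq_sym -subr_eq0 addrAC subrr add0r (negbTE z0).
apply/funext => t.
case: i im => [z|] im; case: j jm => [w|] jm /=;
  rewrite ?(jumpE, sleep_atE) //; have [tx|_] := eqVneq t x;
  have [ty|_] := eqVneq t y => //; subst => //; rewrite ?eqxx // in yx *;
  rewrite ?nb // ?ex ?ey; case: eqP => //= _; do ?case: eqP => //=.
- by case: m ey.
- by case: n ex.
Qed.

Lemma fsum_seq (R : nmodType) (T : choiceType) (r : seq T) (F : T -> R) :
  uniq r -> (forall i, i \notin r -> F i = 0) ->
  \sum_(i \in [set: T]) F i = \sum_(i <- r) F i.
Proof.
move=> ur F0; rewrite (@fsbigE _ _ _ _ _ r) // => [|i _]; last exact: F0.
by apply: eq_bigl => i; rewrite in_setT.
Qed.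

(** * Toppling operators, stabilization and the abelian property *)

Section Toppling.
Context {R : realType} {d : nat} (lambda : R) (p : site d -> R).

Definition weight (i : option (site d)) : R :=
  if i is Some z then p z / (1 + lambda) else lambda / (1 + lambda).

(** The randomness acts on observables: this is the expectation of [f] after one random instruction
    at [x], so that no stacks of instructions have to be built. *)
Definition topple (f : config d -> R) (x : site d) (eta : config d) : R :=
  \sum_(i <- instructions d) weight i * f (act x i eta).

(* Stabilization by at most n topplings: the expectation of f at the final
   configuration on the event that it has been reached.  By [stabilizeS] the
   site toppled first is irrelevant. *)
Fixpoint stabilize (n : nat) (f : config d -> R) (eta : config d) : R :=
  if stable eta then f eta
  else if n is m.+1 then topple (stabilize m f) (some_active eta) eta else 0.

Lemma eq_topple f g x eta :
  (forall i, i \in instructions d -> f (act x i eta) = g (act x i eta)) ->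
  topple f x eta = topple g x eta.
Proof. by move=> fg; apply: eq_big_seq => i /fg ->. Qed.

Lemma toppleB f g x eta :
  topple (fun e => f e - g e) x eta = topple f x eta - topple g x eta.
Proof. by rewrite /topple -sumrB; apply: eq_bigr => i _; rewrite mulrBr. Qed.

Lemma toppleZ a f x eta : topple (fun e => a * f e) x eta = a * topple f x eta.
Proof. by rewrite /topple mulr_sumr; apply: eq_bigr => i _; rewrite mulrCA. Qed.

Lemma topple_sum (I : Type) (r : seq I) (f : I -> config d -> R) x eta :
  topple (fun e => \sum_(k <- r) f k e) x eta = \sum_(k <- r) topple (f k) x eta.
Proof.
rewrite /topple exchange_big /=; apply: eq_bigr => i _.
by rewrite mulr_sumr.
Qed.

Lemma topple_comm f x y eta : y != x -> active eta x -> active eta y ->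
  topple (topple f x) y eta = topple (topple f y) x eta.
Proof.
move=> yx ax ay; rewrite /topple.
under eq_bigr do rewrite mulr_sumr.
under [RHS]eq_bigr do rewrite mulr_sumr.
rewrite exchange_big /=; apply: eq_big_seq => i im; apply: eq_big_seq => j jm.
by rewrite mulrCA act_comm.
Qed.

Lemma stabilize_stable n f eta : stable eta -> stabilize n f eta = f eta.
Proof. by case: n => [|n] /= ->. Qed.

(** If [y] is not the chosen site [x], each of the two stays active when the other is toppled. The
    induction hypothesis then lets either follow the other, and [topple_comm] exchanges them. With a
    budget of one toppling neither site can lead to a stable configuration, and both sides
    vanish. *)
Lemma stabilizeS n f y eta : active eta y ->
  stabilize n.+1 f eta = topple (stabilize n f) y eta.
Proof.
elim: n y eta => [|n IHn] y eta ay; rewrite [LHS]/= (negbTE (active_nstable ay)).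
  set x := some_active eta; have ax : active eta x.
    exact: active_some_active (active_nstable ay).
  have [->//|yx] := eqVneq y x.
  have top0 u v : u != v -> active eta v -> topple (stabilize 0 f) u eta = 0.
    move=> uv av; rewrite /topple big1 // => i _.
    by rewrite /= (negbTE (active_nstable (active_act _ uv av))) mulr0.
  by rewrite (top0 x y) ?(top0 y x) // eq_sym.
set x := some_active eta; have ax : active eta x.
  exact: active_some_active (active_nstable ay).
rewrite -/(stabilize n.+1 f).
have [->//|yx] := eqVneq y x.
rewrite (@eq_topple _ (topple (stabilize n f) y)) => [|i _]; last first.
  by rewrite (IHn y) // active_act // eq_sym.
rewrite -topple_comm //; apply: eq_topple => i _.
by rewrite (IHn x) // active_act.
Qed.

Context (lambda_gt0 : 0 < lambda) (p_jump : jump_distribution p).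

Let lambda1_gt0 : 0 < 1 + lambda.
Proof. by rewrite addr_gt0. Qed.

Let theta_ge0 : 0 <= lambda / (1 + lambda).
Proof. by rewrite divr_ge0 // ltW. Qed.

Lemma weight_ge0 i : 0 <= weight i.
Proof.
case: i => [z|] //=; rewrite divr_ge0 ?(ltW lambda1_gt0) //.
by have [] := p_jump.
Qed.

Lemma sum_neighbours : \sum_(z <- neighbours d) p z = 1.
Proof.
have [_ pn <- _] := p_jump.
rewrite (@fsum_seq _ _ (neighbours d)) ?undup_uniq // => z zn.
by apply/eqP/negPn/negP => /pn/mem_neighbours; apply/negP.
Qed.

Lemma sum_weight : \sum_(i <- instructions d) weight i = 1.
Proof.
rewrite big_cons big_map /= -mulr_suml sum_neighbours -mulrDl addrC.
by rewrite divff ?lt0r_neq0 ?lambda1_gt0.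
Qed.

Lemma topple_cst a x eta : topple (fun=> a) x eta = a.
Proof. by rewrite /topple -mulr_suml sum_weight mul1r. Qed.

Lemma le_topple f g x eta :
  (forall i, i \in instructions d -> f (act x i eta) <= g (act x i eta)) ->
  topple f x eta <= topple g x eta.
Proof.
move=> fg; rewrite /topple big_seq [leRHS]big_seq; apply: ler_sum => i im.
by rewrite ler_wpM2l ?weight_ge0 ?fg.
Qed.

Lemma stabilize_ge0 n f eta : (forall e, 0 <= f e) -> 0 <= stabilize n f eta.
Proof.
move=> f0; elim: n eta => [|n IHn] eta /=; case: ifP => // _.
by rewrite -(topple_cst 0 (some_active eta) eta); apply: le_topple.
Qed.

Lemma stabilizeZ n a f eta :
  stabilize n (fun e => a * f e) eta = a * stabilize n f eta.
Proof.
elim: n eta => [|n IHn] eta /=; case: ifP => // _; first by rewrite mulr0.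
by rewrite -toppleZ; apply: eq_topple.
Qed.

Lemma stabilize_sum (I : Type) (r : seq I) (f : I -> config d -> R) n eta :
  stabilize n (fun e => \sum_(k <- r) f k e) eta =
  \sum_(k <- r) stabilize n (f k) eta.
Proof.
elim: n eta => [|n IHn] eta.
  by rewrite /=; case: ifP => // _; rewrite big1.
rewrite /=; case: ifP => // _.
by rewrite -topple_sum; apply: eq_topple => i _; rewrite IHn.
Qed.

(** The choice [some_active] need not commute with translations, but by [stabilizeS] the shifted
    configuration may topple the shifted site instead. *)
Lemma stabilize_shift n f z eta :
  stabilize n f (Defs.shift z eta) = stabilize n (fun e => f (Defs.shift z e)) eta.
Proof.
have actS x i e : Defs.shift z (act (x + z) i e) = act x i (Defs.shift z e).
  apply/funext => t; rewrite /Defs.shift; case: i => [w|] /=;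
    rewrite ?(jumpE, sleep_atE) (inj_eq (addIr _)) //.
  by rewrite addrAC (inj_eq (addIr _)).
have stS e : stable (Defs.shift z e) = stable e.
  apply/asboolP/asboolP => st x; last exact: st.
  by rewrite -[x](subrK z); exact: st.
elim: n eta => [|n IHn] eta; first by rewrite /= stS.
have [st|st] := boolP (stable eta); first by rewrite !stabilize_stable ?stS.
have ax := active_some_active st; set x := some_active eta in ax.
rewrite (stabilizeS _ _ ax) (@stabilizeS _ _ (x - z)); last first.
  by rewrite /active /Defs.shift subrK.
by apply: eq_bigr => i _; rewrite -IHn -actS subrK.
Qed.

(** [stabilize n (fun=> 1)] is the probability that at most [n] topplings suffice to stabilize. *)
Lemma stab1_le1 n eta : stabilize n (fun=> 1) eta <= 1.
Proof.
elim: n eta => [|n IHn] eta /=; case: ifP => // _.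
by rewrite -[leRHS](topple_cst 1 (some_active eta) eta); apply: le_topple.
Qed.

(* Under weak stabilization, [x] is toppled only when every other site is
   stable; a lone particle at [x] then falls asleep, ending the process, with
   probability lambda / (1 + lambda). *)
Lemma stabilize_occupied n x eta : active eta x ->
  lambda / (1 + lambda) * stabilize n (fun=> 1) eta <=
  stabilize n (fun e => (occupied x e)%:R) eta.
Proof.
elim: n eta => [|n IHn] eta ax.
  by rewrite /= (negbTE (active_nstable ax)) mulr0.
(* As long as some toppling surely leaves [x] active, perform it and use induction. Otherwise no
   other site is active, and [x] carries just one particle, since with two or more it could itself
   be toppled. *)
have [[y ay yP]|no] := pselect (exists2 y, active eta y &
    forall i, i \in instructions d -> active (act y i eta) x).
  rewrite !(stabilizeS _ _ ay) -toppleZ; apply: le_topple => i im.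
  exact/IHn/yP.
have noty y : y != x -> ~~ active eta y.
  move=> yx; apply/negP => ay; apply: no; exists y => // i _.
  exact: active_act.
have ex : eta x = Active 1%N.
  move/activeP: ax => [[//|m] ex]; case: no; exists x; first by rewrite /active ex.
  move=> i _; rewrite /active; case: i => [z|] /=;
    by rewrite ?(jumpE, sleep_atE) eqxx ex.
rewrite [leRHS](stabilizeS _ _ ax) /topple big_cons.
(* The sleep instruction alone accounts for theta: it stabilizes at once with [x] occupied. The
   remaining instructions contribute nonnegative terms. *)
apply: (@le_trans _ _ (weight None)).
  by apply: ler_piMr; [exact: theta_ge0|exact: stab1_le1].
rewrite stabilize_stable; last first.
  apply/asboolP => t; rewrite /active /= sleep_atE; case: eqP => [->|/eqP tx].
    by rewrite ex.
  exact: noty.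
rewrite /occupied /= sleep_atE eqxx ex /= mulr1 lerDl sumr_ge0 // => i _.
by rewrite mulr_ge0 ?weight_ge0 ?stabilize_ge0.
Qed.

End Toppling.

(** * Bounds on the number of particles and their behaviour under topplings *)

Definition mass_le {d : nat} (N : nat) (eta : config d) : Prop :=
  forall W : seq (site d), uniq W -> (\sum_(x <- W) occ_abs (eta x) <= N)%N.

(** As in [mass_le], all finite partial sums are bounded, which avoids an infinite sum of occupation
    numbers. *)
Definition active_le {d : nat} (N : nat) (eta : config d) : Prop :=
  forall W : seq (site d), uniq W -> (\sum_(x <- W) occ_active (eta x) <= N)%N.

Lemma leq_sum_sub (T : eqType) (F : T -> nat) (r s : seq T) :
  uniq r -> uniq s -> {subset r <= s} ->
  (\sum_(x <- r) F x <= \sum_(x <- s) F x)%N.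
Proof.
move=> ur us rs; apply: (uniq_sub_le_big (le := leq)) => // m n.
exact: leq_addr.
Qed.

(** Enlarges a window so that it contains both ends of a particle transfer: loss and gain then
    appear in the same partial sum. *)
Definition adjoin (T : eqType) (x y : T) (W : seq T) :=
  [:: x, y & [seq z <- undup W | (z != x) && (z != y)]].

Lemma adjoin_uniq (T : eqType) (x y : T) (W : seq T) :
  x != y -> uniq (adjoin x y W).
Proof.
move=> xy; rewrite /= in_cons !mem_filter !eqxx /= (negbTE xy) andbF /=.
by rewrite filter_uniq ?undup_uniq.
Qed.

Lemma sub_adjoin (T : eqType) (x y : T) (W : seq T) :
  {subset W <= adjoin x y W}.
Proof.
move=> z zW; rewrite !in_cons mem_filter mem_undup zW andbT.
by case: eqP => //= _; case: eqP.
Qed.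

Lemma mass_le_transfer (d N : nat) (x y : site d) (eta eta' : config d) :
  x != y -> mass_le N eta ->
  (occ_abs (eta' x) + 1 <= occ_abs (eta x))%N ->
  (occ_abs (eta' y) <= occ_abs (eta y) + 1)%N ->
  (forall z, z != x -> z != y -> eta' z = eta z) ->
  mass_le N eta'.
Proof.
move=> xy etaN ex ey ez W uW.
apply: leq_trans (leq_sum_sub _ uW (adjoin_uniq W xy) (@sub_adjoin _ x y W)) _.
apply: leq_trans (etaN _ (adjoin_uniq W xy)); rewrite !big_cons.
under eq_big_seq => z do [rewrite mem_filter => /andP[/andP[zx zy] _]; rewrite ez //].
by move: (\sum_(_ <- _) _) => S; lia.
Qed.

Lemma active_le_transfer (d N : nat) (x y : site d) (eta eta' : config d) :
  x != y -> active_le N.+1 eta ->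
  (occ_active (eta' x) + 1 <= occ_active (eta x))%N ->
  (occ_active (eta' y) <= occ_active (eta y))%N ->
  (forall z, z != x -> z != y -> eta' z = eta z) ->
  active_le N eta'.
Proof.
move=> xy etaN ex ey ez W uW.
apply: leq_trans (leq_sum_sub _ uW (adjoin_uniq W xy) (@sub_adjoin _ x y W)) _.
rewrite -ltnS; apply: leq_trans (etaN _ (adjoin_uniq W xy)); rewrite !big_cons.
under eq_big_seq => z do [rewrite mem_filter => /andP[/andP[zx zy] _]; rewrite ez //].
by move: (\sum_(_ <- _) _) => S; lia.
Qed.

Lemma mass_le_active (d N : nat) (eta : config d) :
  mass_le N eta -> active_le N eta.
Proof.
move=> etaN W uW; apply: leq_trans (etaN W uW); apply: leq_sum => x _.
by case: (eta x).
Qed.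

Lemma mass_le_act (d N : nat) (x : site d) i (eta : config d) :
  i \in instructions d -> active eta x -> mass_le N eta ->
  mass_le N (act x i eta).
Proof.
move=> im /activeP[n ex] etaN; case: i im => [z|_] /=.
  rewrite Some_instructions => /neighbours_neq0 z0.
  have xz : x != x + z by rewrite eq_sym -subr_eq0 addrAC subrr add0r.
  apply: (mass_le_transfer xz etaN); rewrite ?jumpE ?eqxx.
  - by rewrite ex /= addn1.
  - by rewrite eq_sym (negbTE xz); case: (eta _) => //= m; rewrite addn1.
  - by move=> t /negbTE tx /negbTE txz; rewrite jumpE tx txz.
move=> W uW; apply: leq_trans (etaN W uW); apply: leq_sum => t _.
by rewrite sleep_atE; case: eqP => // ->; rewrite ex; case: n {ex}.
Qed.

Lemma mass_le_active_seq (d N : nat) (eta : config d) : mass_le N eta ->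
  exists2 s : seq (site d), uniq s & forall x, active eta x -> x \in s.
Proof.
move=> /mass_le_active etaN.
have [fin|inf] := pselect (finite_set [set x | active eta x]).
  have [s es] := (finite_seqP _).1 fin.
  exists (undup s); rewrite ?undup_uniq // => x ax; rewrite mem_undup.
  by have : [set` s]%classic x by rewrite -es.
have [B BA] := infinite_set_fset N.+1 inf.
rewrite leqNgt => /negP; case; rewrite ltnS.
apply: leq_trans (etaN B (fset_uniq B)).
rewrite -sum1_size big_seq [leqRHS]big_seq; apply: leq_sum => x xB.
exact: BA.
Qed.

(** * Stabilization terminates, uniformly over configurations of bounded mass *)

Section Termination.
Context {R : realType} {d : nat} (lambda : R) (p : site d -> R).
Context (lambda_gt0 : 0 < lambda) (p_jump : jump_distribution p).

Local Notation stab := (stabilize lambda p).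
Local Notation G n := (stabilize lambda p n (fun=> 1)).

Lemma stab1_ge0 n eta : 0 <= G n eta.
Proof. exact: stabilize_ge0. Qed.

Lemma stab1_leS n eta : G n eta <= G n.+1 eta.
Proof.
elim: n eta => [|n IHn] eta.
  have [st|st] := boolP (stable eta); first by rewrite !stabilize_stable.
  by rewrite [leLHS]/= (negbTE st) stab1_ge0.
have [st|st] := boolP (stable eta); first by rewrite !stabilize_stable.
have ax := active_some_active st.
by rewrite !(stabilizeS _ _ _ _ ax); apply: le_topple.
Qed.

Lemma stab1_le m n eta : (m <= n)%N -> G m eta <= G n eta.
Proof.
move=> /subnK <-; elim: (n - m)%N => [//|k IHk].
by rewrite addSn (le_trans IHk) // stab1_leS.
Qed.

Context (e : site d) (e_nbr : e \in neighbours d) (pe_gt0 : 0 < p e).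

(** Bounds from below the weights of the only two instructions prescribed in the termination
    argument, sleeping and jumping by [e]. *)
Definition step_prob : R :=
  Num.min (weight lambda p None) (weight lambda p (Some e)).

Lemma step_prob_gt0 : 0 < step_prob.
Proof.
by rewrite lt_min /= !divr_gt0 // addr_gt0.
Qed.

Lemma step_prob_le1 : step_prob <= 1.
Proof.
rewrite ge_min /= ler_pdivrMr ?addr_gt0 // mul1r lerDr ler01 //.
Qed.

(** Stands for: [k] prescribed topplings lead from [eta] to [eta'] with probability at least
    [step_prob ^+ k]. Only the consequence for termination probabilities is recorded. *)
Definition reaches (k : nat) (eta eta' : config d) : Prop :=
  forall n, step_prob ^+ k * G n eta' <= G (n + k)%N eta.

Lemma reaches_trans k l a b c : reaches k a b -> reaches l b c ->
  reaches (k + l)%N a c.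
Proof.
move=> ab bc n; have -> : (n + (k + l) = n + l + k)%N by lia.
rewrite exprD -mulrA (le_trans _ (ab _)) //.
by rewrite ler_pM2l ?exprn_gt0 ?step_prob_gt0 // bc.
Qed.

Lemma reaches_act x i eta : i = None \/ i = Some e -> active eta x ->
  reaches 1 eta (act x i eta).
Proof.
move=> ie ax n.
have im : i \in instructions d.
  by case: ie => -> //; rewrite Some_instructions.
rewrite addn1 expr1 (stabilizeS _ _ _ _ ax) /topple.
rewrite (bigD1_seq i) ?uniq_instructions //= -[leLHS]addr0 lerD //; last first.
  by apply: sumr_ge0 => j _; rewrite mulr_ge0 ?weight_ge0 ?stab1_ge0.
rewrite ler_wpM2r ?stab1_ge0 // /step_prob.
by case: ie => ->; rewrite ge_min lexx ?orbT.
Qed.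

Let e_neq0 : e != 0 := neighbours_neq0 e_nbr.

Let mulrn_e_eq0 m : (e *+ m == 0) = (m == 0%N).
Proof.
apply/eqP/eqP => [em|->]; last by rewrite mulr0n.
apply/eqP; move: e_neq0; apply: contraNT => m0.
apply/eqP/matrixP => i j; move/matrixP: em => /(_ i j).
by rewrite mulmxnE !mxE => /eqP; rewrite mulrn_eq0 (negbTE m0) => /eqP.
Qed.

Let shift_neq y m : (y + e *+ m.+1 == y) = false.
Proof. by rewrite -{2}[y]addr0 (inj_eq (addrI y)) mulrn_e_eq0. Qed.

Let shift_inj y : injective (fun m => y + e *+ m).
Proof.
suff le m n : (m <= n)%N -> y + e *+ m = y + e *+ n -> m = n.
  by move=> m n; case: (leqP m n) => [|/ltnW] mn mne; [|apply/esym];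
    apply: le.
move=> /subnK <-; rewrite addnC mulrnDr addrA => /esym/eqP.
rewrite -[X in _ == X]addr0 (inj_eq (addrI _)) mulrn_e_eq0 => /eqP ->.
by rewrite addn0.
Qed.

(* A particle of [y] travels over a row of sleeping particles to the first
   vacant site and falls asleep there, every site passed falling asleep again. *)
Lemma reaches_vacant m y eta : active eta y ->
  (forall j, (0 < j <= m)%N -> eta (y + e *+ j) = Sleeping) ->
  eta (y + e *+ m.+1) = Active 0 ->
  reaches (2 * m + 2) eta
    (fun t => if t == y then occ_pred (eta y)
              else if t == y + e *+ m.+1 then Sleeping else eta t).
Proof.
elim: m y eta => [|m IHm] y eta ay eS e0.
  rewrite mulr1n in e0 *; have ye := shift_neq y 0; rewrite mulr1n in ye.
  have r1 := reaches_act (or_intror erefl) ay.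
  have a1 : active (act y (Some e) eta) (y + e).
    by rewrite /active /= jumpE ye eqxx e0.
  have := reaches_trans r1 (reaches_act (or_introl erefl) a1).
  rewrite muln0; congr (reaches _ _ _); apply/funext => t /=.
  rewrite sleep_atE !jumpE; have [->|ty] := eqVneq t y; first by rewrite eq_sym ye.
  by case: eqP => [->|//]; rewrite e0.
have ye := shift_neq y 0; rewrite mulr1n in ye.
have ySS j : y + e + e *+ j = y + e *+ j.+1 by rewrite mulrS addrA.
have yej j : (y + e + e *+ j.+1 == y) = false by rewrite ySS shift_neq.
have eS1 : eta (y + e) = Sleeping by have := eS 1%N isT; rewrite mulr1n.
have r1 := reaches_act (or_intror erefl) ay.
(* The jump wakes the sleeper at [y + e]. Of the two particles there, one travels on by induction,
   and the other, left alone, falls asleep and restores the row: two topplings more than for [m]. *)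
set eta1 := act y (Some e) eta in r1.
have e1 : eta1 (y + e) = Active 2 by rewrite /eta1 /= jumpE ye eqxx eS1.
have a1 : active eta1 (y + e) by rewrite /active e1.
have {IHm} := IHm _ _ a1 _ _; set eta2 := (X in reaches _ _ X) => r2.
have {}r2 : reaches (2 * m + 2) eta1 eta2.
  apply: r2 => [j /andP[]|]; last by rewrite /eta1 /= jumpE yej shift_neq ySS.
  case: j => // j _ jm.
  by rewrite /eta1 /= jumpE yej shift_neq ySS eS.
have e2 : eta2 (y + e) = Active 1 by rewrite /eta2 eqxx e1.
have a2 : active eta2 (y + e) by rewrite /active e2.
have := reaches_trans (reaches_trans r1 r2) (reaches_act (or_introl erefl) a2).
have -> : (1 + (2 * m + 2) + 1 = 2 * m.+1 + 2)%N by lia.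
congr (reaches _ _ _); apply/funext => t /=.
rewrite sleep_atE; have [->|tye] := eqVneq t (y + e).
  by rewrite e2 ye -ySS eq_sym shift_neq eS1.
rewrite /eta2 (negbTE tye) ySS; have [->|ty] := eqVneq t y.
  by rewrite eq_sym shift_neq /eta1 /= jumpE eqxx.
by rewrite /eta1 /= jumpE (negbTE ty) (negbTE tye).
Qed.

(** Induction on the number of active particles: each round puts one of them to sleep at a vacant
    site, using at most 2N + 2 topplings. *)
Lemma reaches_stable N a eta : mass_le N eta -> active_le a eta ->
  exists k eta', [/\ (k <= a * (2 * N + 2))%N, stable eta' & reaches k eta eta'].
Proof.
elim: a eta => [|a IHa] eta etaN etaa.
  exists 0%N, eta; split => // [|n]; last by rewrite expr0 mul1r addn0.
  apply/asboolP => x; have := etaa [:: x] isT.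
  by rewrite big_cons big_nil addn0 leqn0 /active lt0n negbK.
have [st|/active_some_active] := boolP (stable eta).
  by exists 0%N, eta; split => // n; rewrite expr0 mul1r addn0.
move: (some_active eta) => y ay.
(* Pigeonhole: [N] particles cannot occupy all of the N + 1 distinct sites y, y + e, ..., y + N
   e. *)
have [j jN ej] : exists2 j, (j <= N)%N & eta (y + e *+ j) == Active 0.
  apply: contrapT => no.
  have := etaN [seq y + e *+ j | j <- iota 0 N.+1].
  rewrite map_inj_uniq ?iota_uniq; last exact: shift_inj.
  move=> /(_ isT); rewrite leqNgt => /negP; apply.
  rewrite -[X in (X <= _)%N](size_iota 0 N.+1) -sum1_size big_map.
  rewrite big_seq [leqRHS]big_seq.
  apply: leq_sum => j; rewrite mem_iota add0n ltnS => jN.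
  rewrite lt0n; apply/negP => ej; apply: no; exists j => //.
  by move: ej; case: (eta _) => //= -[].
have exj : exists j, eta (y + e *+ j) == Active 0 by exists j.
case: (ex_minnP exj) => j0 ej0 j0min.
have {}jN : (j0 <= N)%N by apply: leq_trans jN; exact: j0min.
have j0_gt0 : (0 < j0)%N.
  rewrite lt0n; apply/eqP => j00; move: ay ej0.
  by rewrite j00 mulr0n addr0 => /activeP[n ->] /eqP.
pose Q i := (i < j0)%N && active eta (y + e *+ i).
have Q0 : exists i, Q i by exists 0%N; rewrite /Q j0_gt0 mulr0n addr0.
have Qmax i : Q i -> (i <= j0)%N by move=> /andP[/ltnW].
(* Between the last active site before the first vacancy and that vacancy, sites are neither vacant
   nor active, hence all sleeping, as [reaches_vacant] requires. *)
case: (ex_maxnP Q0 Qmax) => i /andP[ij ai] imax.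
pose m := (j0 - i).-1; pose y' := y + e *+ i.
have yE k : y' + e *+ k = y + e *+ (i + k) by rewrite /y' -addrA -mulrnDr.
have im : (i + m.+1 = j0)%N by rewrite /m; lia.
have sl k : (0 < k <= m)%N -> eta (y' + e *+ k) = Sleeping.
  move=> km; rewrite yE; case E: (eta _) => [[|n]|//].
    by have := j0min (i + k)%N; rewrite E eqxx => /(_ isT); lia.
  have := imax (i + k)%N; rewrite /Q /active E /= andbT.
  by move=> h; have := h ltac:(lia); lia.
have va : eta (y' + e *+ m.+1) = Active 0 by rewrite yE im; exact/eqP.
have := reaches_vacant ai sl va; set eta' := (X in reaches _ _ X) => r.
have yy : y' != y' + e *+ m.+1 by rewrite eq_sym shift_neq.
have [n ey] := activeP _ _ ai.
have [||k [eta'' [kN st r']]] := IHa eta'.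
- apply: (mass_le_transfer yy etaN).
  + by rewrite /eta' eqxx ey /= addn1.
  + by rewrite /eta' eq_sym (negbTE yy) eqxx addn1.
  + by move=> z /negbTE zy /negbTE zy'; rewrite /eta' zy zy'.
- apply: (active_le_transfer yy etaa).
  + by rewrite /eta' eqxx ey /= addn1.
  + by rewrite /eta' eq_sym (negbTE yy) eqxx.
  + by move=> z /negbTE zy /negbTE zy'; rewrite /eta' zy zy'.
exists (2 * m + 2 + k)%N, eta''; split => //; last exact: reaches_trans r r'.
by rewrite mulSn leq_add //; lia.
Qed.

Lemma stab1_lower N eta : mass_le N eta ->
  step_prob ^+ (N * (2 * N + 2)) <= G (N * (2 * N + 2)) eta.
Proof.
move=> etaN; have [k [eta' [kN st r]]] :=
  reaches_stable etaN (mass_le_active etaN).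
have := r 0%N; rewrite add0n [G 0 _]stabilize_stable // mulr1 => le1.
apply: le_trans (stab1_le _ kN); apply: le_trans le1.
apply: ler_wiXn2l => //; [exact: ltW step_prob_gt0|exact: step_prob_le1].
Qed.

(** From any configuration left after the first [n] topplings, a further block of N(2N + 2)
    topplings stabilizes with probability bounded below by [stab1_lower], because the mass bound is
    preserved. *)
Lemma stab1_contract N n eta : mass_le N eta ->
  1 - G (n + N * (2 * N + 2)) eta <=
  (1 - step_prob ^+ (N * (2 * N + 2))) * (1 - G n eta).
Proof.
set K := (N * _)%N; elim: n eta => [|n IHn] eta etaN.
  have [st|st] := boolP (stable eta).
    by rewrite !stabilize_stable // subrr mulr0.
  by rewrite add0n [G 0 eta]/= (negbTE st) subr0 mulr1 lerB // stab1_lower.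
have [st|st] := boolP (stable eta).
  by rewrite !stabilize_stable // subrr mulr0.
have ax := active_some_active st; set x := some_active eta in ax.
rewrite addSn !(stabilizeS _ _ _ _ ax).
rewrite -[X in X - _](topple_cst lambda_gt0 p_jump 1 x eta).
rewrite -[X in _ * (X - _)](topple_cst lambda_gt0 p_jump 1 x eta).
rewrite -!toppleB -toppleZ; apply: le_topple => // i im.
by apply: IHn; exact: mass_le_act.
Qed.

(** The probability of failure decays geometrically in the number of blocks, at a rate that depends
    on [eta] only through [N]; hence one [n] serves all configurations. *)
Lemma stab1_cvg N (eps : R) : 0 < eps ->
  exists n, forall eta, mass_le N eta -> 1 - eps <= G n eta.
Proof.
move=> eps0; pose K := (N * (2 * N + 2))%N; pose q := 1 - step_prob ^+ K.
have sK0 : 0 < step_prob ^+ K by rewrite exprn_gt0 // step_prob_gt0.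
have q0 : 0 <= q.
  by rewrite subr_ge0 exprn_ile1 // ?step_prob_le1 // ltW ?step_prob_gt0.
have q1 : q < 1 by rewrite /q ltrBlDr ltrDl.
have [m qm] : exists m, q ^+ m < eps.
  have := @cvg_expr R q; rewrite ger0_norm // => /(_ q1)/cvgrPdist_lt/(_ _ eps0).
  case=> m _ /(_ m (leqnn m)); rewrite sub0r normrN ger0_norm ?exprn_ge0 //.
  by exists m.
exists (m * K)%N => eta etaN; rewrite lerBlDr -lerBlDl.
apply: le_trans (ltW qm); elim: m {qm} => [|m IHm].
  by rewrite expr0 lerBlDr lerDl stab1_ge0.
rewrite mulSn addnC (le_trans (stab1_contract _ etaN)) //.
by rewrite exprS ler_wpM2l.
Qed.

End Termination.

(** * Comparison of the jump chain with stabilization *)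

Section JumpChain.
Context {R : realType} {d : nat} (lambda : R) (p : site d -> R).
Context (lambda_gt0 : 0 < lambda) (p_jump : jump_distribution p).

Local Notation stab := (stabilize lambda p).
Local Notation theta := (lambda / (1 + lambda)).

(** Expectation over the site whose clock rings first; meaningful when some site is active, so that
    the total rate is positive. *)
Definition ring_average (F : site d -> R) (eta : config d) : R :=
  \sum_(y \in [set: site d])
    clock_rate lambda eta y / total_rate lambda eta * F y.

(* The probability that the jump chain becomes stable within n clock rings and
   never has an active particle at x. *)
Fixpoint quiet (x : site d) (n : nat) (eta : config d) : R :=
  if active eta x then 0
  else if stable eta then 1
  else if n is m.+1 then
    ring_average (fun y => topple lambda p (quiet x m) y eta) eta
  else 0.

Let lambda1_gt0 : 0 < 1 + lambda.
Proof. by rewrite addr_gt0. Qed.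

Lemma clock_rate_nactive (eta : config d) y :
  ~~ active eta y -> clock_rate lambda eta y = 0.
Proof.
by rewrite /clock_rate /active lt0n negbK => /eqP ->; rewrite mulr0.
Qed.

Lemma total_rate_seq s (eta : config d) :
  uniq s -> (forall x, active eta x -> x \in s) ->
  total_rate lambda eta = \sum_(y <- s) clock_rate lambda eta y.
Proof.
move=> us sP; apply: fsum_seq => // y ys; apply: clock_rate_nactive.
by apply: contra ys => /sP.
Qed.

Lemma ring_average_seq s F eta : uniq s -> (forall x, active eta x -> x \in s) ->
  ring_average F eta =
  \sum_(y <- s) clock_rate lambda eta y / total_rate lambda eta * F y.
Proof.
move=> us sP; apply: fsum_seq => // y ys.
by rewrite clock_rate_nactive ?mul0r //; apply: contra ys => /sP.
Qed.

Lemma clock_rate_ge0 (eta : config d) y : 0 <= clock_rate lambda eta y.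
Proof. by rewrite mulr_ge0 // ltW. Qed.

Lemma total_rate_stable (eta : config d) : stable eta -> total_rate lambda eta = 0.
Proof.
move=> st; rewrite /total_rate fsbig1 // => y _.
by rewrite clock_rate_nactive // stable_nactive.
Qed.

Lemma total_rate_gt0 N (eta : config d) : mass_le N eta -> ~~ stable eta ->
  0 < total_rate lambda eta.
Proof.
move=> /mass_le_active_seq[s us sP] /active_some_active ax.
rewrite (total_rate_seq us sP) (bigD1_seq _ (sP _ ax)) //= ltr_wpDr //.
  by apply: sumr_ge0 => y _; exact: clock_rate_ge0.
by rewrite mulr_gt0 // ltr0n.
Qed.

Lemma ring_average_cst N a eta : mass_le N eta -> ~~ stable eta ->
  ring_average (fun=> a) eta = a.
Proof.
move=> etaN st; have t0 := total_rate_gt0 etaN st.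
have [s us sP] := mass_le_active_seq etaN.
rewrite (ring_average_seq _ us sP) -mulr_suml -mulr_suml -(total_rate_seq us sP).
by rewrite divff ?mul1r // gt_eqF.
Qed.

Lemma le_ring_average N F F' eta : mass_le N eta ->
  (forall y, active eta y -> F y <= F' y) ->
  ring_average F eta <= ring_average F' eta.
Proof.
move=> etaN FF'; have [s us sP] := mass_le_active_seq etaN.
rewrite !(ring_average_seq _ us sP); apply: ler_sum => y _.
have [ay|/clock_rate_nactive ->] := boolP (active eta y); last by rewrite !mul0r.
have t0 : 0 < total_rate lambda eta.
  by apply: total_rate_gt0 etaN _; exact: active_nstable ay.
by rewrite ler_wpM2l ?FF' // divr_ge0 ?clock_rate_ge0 // ltW.
Qed.

Lemma quiet_le1 N x n eta : mass_le N eta -> quiet x n eta <= 1.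
Proof.
elim: n eta => [|n IHn] eta etaN /=; case: ifP => // _; case: ifPn => // st.
rewrite -[leRHS](ring_average_cst 1 etaN st); apply: (le_ring_average etaN).
move=> y ay; rewrite -[leRHS](topple_cst lambda_gt0 p_jump 1 y eta).
by apply: (le_topple lambda_gt0 p_jump) => i im; apply: IHn; exact: mass_le_act.
Qed.

(** The clocks merely choose which active site is toppled next, and by [stabilizeS] this choice does
    not affect [stabilize]. So the inequality is averaged along the chain until [x] becomes active,
    where [stabilize_occupied] applies, or until the chain is stable, where the left side is 0. *)
Lemma visited_le N x n eta : mass_le N eta ->
  theta * (stab n (fun=> 1) eta - quiet x n eta) <=
  stab n (fun e => (occupied x e)%:R) eta.
Proof.
have F0 m e : 0 <= stab m (fun e => (occupied x e)%:R) e.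
  exact: stabilize_ge0.
elim: n eta => [|n IHn] eta etaN.
  rewrite /=; case: ifP => [st|_]; last by case: ifP; rewrite subrr mulr0.
  by rewrite (negbTE (stable_nactive _ st)) subrr mulr0 ler0n.
have [ax|ax] := boolP (active eta x).
  by rewrite [quiet _ _ _]/= ax subr0 stabilize_occupied.
have [st|st] := boolP (stable eta).
  by rewrite [quiet _ _ _]/= (negbTE ax) st stabilize_stable // subrr mulr0.
rewrite [quiet _ _ _]/= (negbTE ax) (negbTE st).
rewrite -[leRHS](ring_average_cst _ etaN st).
rewrite -[X in _ * (X - _)](ring_average_cst _ etaN st).
have [s us sP] := mass_le_active_seq etaN.
rewrite !(ring_average_seq _ us sP) -sumrB mulr_sumr.
have t0 := total_rate_gt0 etaN st.
apply: ler_sum => y _.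
have [ay|/clock_rate_nactive ->] := boolP (active eta y); last first.
  by rewrite !mul0r subrr mulr0.
rewrite -mulrBr mulrCA ler_wpM2l ?divr_ge0 ?clock_rate_ge0 ?(ltW t0) //.
rewrite !(stabilizeS _ _ _ _ ay) -toppleB -toppleZ.
by apply: (le_topple lambda_gt0 p_jump) => // i im; apply: IHn; exact: mass_le_act.
Qed.

Lemma le_stabilize N f g n eta : mass_le N eta ->
  (forall e, mass_le N e -> f e <= g e) -> stab n f eta <= stab n g eta.
Proof.
move=> + fg; elim: n eta => [|n IHn] eta etaN /=; case: ifPn => [_|st].
- exact: fg.
- by [].
- exact: fg.
- apply: (le_topple lambda_gt0 p_jump) => // i im; apply: IHn.
  by apply: mass_le_act => //; exact: active_some_active.
Qed.

(** Topplings preserve the bound on the mass, so a final configuration occupies at most [N]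
    sites. *)
Lemma sum_stabilize_occupied N n W eta : uniq W -> mass_le N eta ->
  \sum_(x <- W) stab n (fun e => (occupied x e)%:R) eta <= N%:R.
Proof.
move=> uW etaN; rewrite -stabilize_sum.
apply: (@le_trans _ _ (stab n (fun=> N%:R * 1) eta)).
  apply: (le_stabilize _ etaN) => e eN; rewrite mulr1.
  rewrite -natr_sum ler_nat (leq_trans _ (eN W uW)) //.
  by apply: leq_sum => x _; rewrite /occupied; case: (occ_abs _).
rewrite stabilizeZ ler_piMr ?ler0n //; exact: stab1_le1.
Qed.

Lemma ring_updateE x eta eta' :
  ring_update lambda p x eta eta' =
  \sum_(i <- instructions d) weight lambda p i * (eta' == act x i eta)%:R.
Proof.
have asE (e e' : config d) : `[< e = e' >] = (e == e').
  by apply/asboolP/eqP.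
rewrite /ring_update asE big_cons big_map; congr (_ + _).
rewrite (@fsum_seq _ _ [seq x + z | z <- neighbours d]).
- rewrite big_map; apply: eq_bigr => z _.
  by rewrite asE addrC addKr.
- by rewrite map_inj_uniq ?undup_uniq //; exact: addrI.
- move=> y yn; have [_ pn _ _] := p_jump.
  have /eqP -> : p (y - x) == 0; last by rewrite !mul0r.
  apply: contraNT yn => /pn/mem_neighbours yx.
  by apply/mapP; exists (y - x) => //; rewrite addrC subrK.
Qed.

(** Duplicates are removed because several pairs of a site and an instruction may give the same
    configuration, whose [ring_kernel] already counts them all. *)
Definition successors (s : seq (site d)) (eta : config d) : seq (config d) :=
  undup [seq act y i eta | y <- s, i <- instructions d].

Lemma sum_ring_kernel N s eta g : mass_le N eta -> ~~ stable eta ->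
  uniq s -> (forall x, active eta x -> x \in s) ->
  \sum_(eta' <- successors s eta) ring_kernel lambda p eta eta' * g eta' =
  ring_average (fun y => topple lambda p g y eta) eta.
Proof.
move=> etaN st us sP; have t0 := total_rate_gt0 etaN st.
rewrite (ring_average_seq _ us sP).
under eq_bigr => eta' _.
  rewrite /ring_kernel gt_eqF //.
  rewrite -[X in X * _]/(ring_average _ eta) (ring_average_seq _ us sP) mulr_suml.
  under eq_bigr do rewrite ring_updateE.
  over.
rewrite exchange_big /=; apply: eq_big_seq => y ys.
under eq_bigr do rewrite -mulrA.
rewrite -mulr_sumr; congr (_ * _).
under eq_bigr do rewrite mulr_suml.
rewrite exchange_big /=; apply: eq_big_seq => i im.
under eq_bigr do rewrite -mulrA.
rewrite -mulr_sumr; congr (_ * _).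
have yS : act y i eta \in successors s eta.
  by rewrite mem_undup; apply: allpairs_f.
rewrite (bigD1_seq _ yS) ?undup_uniq //= eqxx mul1r big1 ?addr0 // => e /negbTE ->.
by rewrite mul0r.
Qed.

Lemma successors_act s eta eta' : eta' \in successors s eta ->
  exists y i, [/\ y \in s, i \in instructions d & eta' = act y i eta].
Proof. by rewrite mem_undup => /allpairsP[[y i] [ys im ->]]; exists y, i. Qed.

Lemma mass_le_successors N s eta eta' : mass_le N eta ->
  {subset s <= active eta} ->
  eta' \in successors s eta -> mass_le N eta'.
Proof.
move=> etaN sa /successors_act[y [i [/sa ys im ->]]]; exact: mass_le_act.
Qed.

Lemma ring_kernel_stable eta : stable eta -> ring_kernel lambda p eta eta = 1.
Proof.
by move=> st; rewrite /ring_kernel total_rate_stable // eqxx asboolT.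
Qed.

End JumpChain.

(** * Measurability of events and configurations *)

Section Measurability.
Context {disp : measure_display} {T : measurableType disp}.

Lemma measurable_exists (I : countType) (P : I -> T -> Prop) :
  (forall i, measurable [set w | P i w]) ->
  measurable [set w | exists i, P i w].
Proof.
move=> mP; rewrite (_ : [set w | _] = \bigcup_i [set w | P i w]).
  by apply: countable_bigcupT_measurable => //; exact: countableP.
by apply/seteqP; split => [w [i Pi]|w [i _ Pi]]; exists i.
Qed.

Lemma measurable_forall (I : countType) (P : I -> T -> Prop) :
  (forall i, measurable [set w | P i w]) ->
  measurable [set w | forall i, P i w].
Proof.
move=> mP; rewrite (_ : [set w | _] = ~` [set w | exists i, ~ P i w]).
  apply: measurableC; apply: measurable_exists => i.
  by rewrite (_ : [set w | _] = ~` [set w | P i w]) //; exact: measurableC.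
apply/seteqP; split => [w Pw [i]|w /forallNP Pw i]; first exact.
exact: contrapT (Pw i).
Qed.

Lemma measurable_imp (C : Prop) (P : T -> Prop) :
  (C -> measurable [set w | P w]) -> measurable [set w | C -> P w].
Proof.
have [c|nc] := pselect C => mP.
  rewrite (_ : [set w | _] = [set w | P w]); first exact: mP.
  by apply/seteqP; split => w //= /(_ c).
rewrite (_ : [set w | _] = setT) //.
by apply/seteqP; split => // w _ /nc.
Qed.

Lemma measurable_and_const (C : Prop) (P : T -> Prop) :
  (C -> measurable [set w | P w]) -> measurable [set w | C /\ P w].
Proof.
have [c|nc] := pselect C => mP.
  rewrite (_ : [set w | _] = [set w | P w]); first exact: mP.
  by apply/seteqP; split => w //= [].
rewrite (_ : [set w | _] = set0) //.
by apply/seteqP; split => // w [/nc].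
Qed.

Lemma sum_prob_le {R : realType} (Pr : probability T R) (I : eqType)
    (s : seq I) (F : I -> set T) (A : set T) :
  uniq s -> measurable A -> (forall i, measurable (F i)) ->
  (forall i, i \in s -> F i `<=` A) ->
  (forall i j, i != j -> F i `&` F j = set0) ->
  \sum_(i <- s) fine (Pr (F i)) <= fine (Pr A).
Proof.
move=> us mA mF + disj; elim: s A us mA => [|i s IHs] A.
  by move=> _ _ _; rewrite big_nil fine_ge0.
rewrite cons_uniq => /andP[is_ us] mA FA; rewrite big_cons.
have FiA : F i `<=` A by apply: FA; rewrite mem_head.
have mAi : measurable (A `\` F i) by exact: measurableD.
have -> : Pr A = (Pr (F i) + Pr (A `\` F i))%E.
  rewrite -measureU //; first by rewrite setDUK.
  by rewrite setDIK.
rewrite fineD ?fin_num_measure // lerD2l; apply: IHs => // j js w Fjw.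
split; first by apply: FA Fjw; rewrite in_cons js orbT.
move=> Fiw; have ij : i != j by apply: contraNneq is_ => ->.
by have : (F i `&` F j) w by []; rewrite disj.
Qed.

End Measurability.

Section ConfigMeasurability.
Context {d : nat}.

Lemma measurable_config_at (x : site d) (a : occ) :
  measurable [set eta : config d | eta x = a].
Proof. by apply: sub_sigma_algebra; exists x, a. Qed.

Lemma measurable_config1 (c : config d) : measurable [set eta : config d | eta = c].
Proof.
rewrite (_ : [set eta | _] = [set eta : config d | forall x, eta x = c x]).
  by apply: measurable_forall => x; exact: measurable_config_at.
by apply/seteqP; split => [eta /= -> //|eta /= h]; apply/funext.
Qed.

Lemma measurable_active (x : site d) : measurable [set eta : config d | active eta x].
Proof.
rewrite (_ : [set eta | _] = [set eta : config d | exists n, eta x = Active n.+1]).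
  by apply: measurable_exists => n; exact: measurable_config_at.
by apply/seteqP; split => eta /= /activeP.
Qed.

End ConfigMeasurability.

(** * From the jump chain with holding times to the event that a site is never active *)

Section HoldingTimes.
Context {R : realType} {d : nat} (lambda : R) (p : site d -> R).
Context (lambda_gt0 : 0 < lambda) (p_jump : jump_distribution p).
Context (nu : probability (config d) R) (V : {fset site d}).
Context {disp : measure_display} {Omega : measurableType disp}.
Context (Pr : probability Omega R).
Context (Y : nat -> Omega -> config d) (H : nat -> Omega -> \bar R).
Context (mY : forall n, measurable_fun [set: Omega] (Y n)).
Context (mH : forall n, measurable_fun [set: Omega] (H n)).
Context (law : forall (n : nat) (c : nat -> config d) (t : nat -> R),
  (forall i, 0 <= t i) ->
  Pr [set w | (forall i, (i <= n)%N -> Y i w = c i) /\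
              (forall i, (i < n)%N -> ((t i)%:E < H i w)%E)] =
  (nu [set eta | restrict_config V eta = c 0%N] *
   (\prod_(i < n) (ring_kernel lambda p (c i) (c i.+1) *
                   expR (- (total_rate lambda (c i) * t i))))%:E)%E).

Let cyl (n : nat) (c : nat -> config d) (t : nat -> R) : set Omega :=
  [set w | (forall i, (i <= n)%N -> Y i w = c i) /\
           (forall i, (i < n)%N -> ((t i)%:E < H i w)%E)].

Let measurable_cyl n c t : measurable (cyl n c t).
Proof.
apply: measurableI; apply: measurable_forall => i; apply: measurable_imp => _.
  rewrite -[X in measurable X]setTI.
  exact: (mY i measurableT (measurable_config1 (c i))).
rewrite -[X in measurable X]setTI.
exact: (emeasurable_fun_o_infty measurableT (mH i)).
Qed.

(** Absorption is expressed by an infinite holding time, since the path is described through its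
    holding times; positivity of the earlier ones keeps their partial sums nonnegative. *)
Definition quiet_event (x : site d) : set Omega :=
  [set w | exists m, [/\ forall i, (i < m)%N -> (0%:E < H i w)%E,
     H m w = +oo%E & forall i, (i <= m)%N -> ~~ active (Y i w) x]].

Lemma measurable_quiet_event x : measurable (quiet_event x).
Proof.
rewrite (_ : quiet_event x = [set w | exists m,
  (forall i, (i < m)%N -> (0%:E < H i w)%E) /\
  (H m w = +oo%E /\ forall i, (i <= m)%N -> ~~ active (Y i w) x)]); last first.
  apply/seteqP; split => w [m]; first by move=> [? ? ?]; exists m.
  by move=> [? [? ?]]; exists m.
apply: measurable_exists => m; apply: measurableI; last apply: measurableI.
- apply: measurable_forall => i; apply: measurable_imp => _.
  rewrite -[X in measurable X]setTI.
  exact: (emeasurable_fun_o_infty measurableT (mH i)).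
- rewrite -[X in measurable X]setTI.
  exact: (mH m measurableT (emeasurable_set1 +oo%E)).
- apply: measurable_forall => i; apply: measurable_imp => _.
  rewrite (_ : [set w | _] = ~` (Y i @^-1` [set eta | active eta x])).
    apply: measurableC; rewrite -[X in measurable X]setTI.
    exact: (mY i measurableT (measurable_active x)).
  by apply/seteqP; split => w /=; move/negP.
Qed.


Let measurable_restrict (c : config d) :
  measurable [set eta : config d | restrict_config V eta = c].
Proof.
rewrite (_ : [set eta | _] =
  [set eta : config d | forall x, restrict_config V eta x = c x]); last first.
  by apply/seteqP; split => [eta /= -> //|eta /= h]; apply/funext.
apply: measurable_forall => x; rewrite /restrict_config.
case: (x \in V); first exact: measurable_config_at.
have [e|ne] := pselect (Active 0 = c x).
  by rewrite (_ : mkset _ = setT) //; apply/seteqP; split.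
by rewrite (_ : mkset _ = set0) //; apply/seteqP; split.
Qed.

(** With thresholds 0 the exponential factors equal 1, so positive holding times come at no cost in
    probability. *)
Let cyl0 n c := cyl n c (fun=> 0).

Let fine_cyl0 n c : fine (Pr (cyl0 n c)) =
  fine (nu [set eta | restrict_config V eta = c 0%N]) *
  \prod_(i < n) ring_kernel lambda p (c i) (c i.+1).
Proof.
have -> : Pr (cyl0 n c) = (nu [set eta | restrict_config V eta = c 0%N] *
   (\prod_(i < n) ring_kernel lambda p (c i) (c i.+1))%:E)%E.
  rewrite law //; congr (_ * (_)%:E)%E; apply: eq_bigr => i _.
  by rewrite mulr0 oppr0 expR0 mulr1.
by rewrite fineM // fin_num_measure //; exact: measurable_restrict.
Qed.

Let extend (c : nat -> config d) (k : nat) (eta : config d) : nat -> config d :=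
  fun i => if (i <= k)%N then c i else eta.

Let prod_extend c k eta :
  \prod_(i < k.+1) ring_kernel lambda p (extend c k eta i) (extend c k eta i.+1) =
  (\prod_(i < k) ring_kernel lambda p (c i) (c i.+1)) *
  ring_kernel lambda p (c k) eta.
Proof.
rewrite big_ord_recr /=; congr (_ * _); last by rewrite /extend leqnn ltnn.
by apply: eq_bigr => i _; rewrite /extend (ltnW (ltn_ord i)) (ltn_ord i).
Qed.

(* The holding time of a stable configuration exceeds every T, hence is
   infinite. *)
Let cyl_stable x k c : (forall i, (i <= k)%N -> ~~ active (c i) x) ->
  stable (c k) -> Pr (cyl0 k c) = Pr (cyl0 k c `&` quiet_event x).
Proof.
move=> cx st.
(* Adds the void transition at the stable [c k] and demands that its holding time exceed [T]. The
   total rate being 0, the extra factor is 1 for every [T]. *)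
pose F (T : nat) := cyl k.+1 (extend c k (c k)) (fun i => if i == k then T%:R else 0).
have FE T : Pr (F T) = Pr (cyl0 k c).
  rewrite [LHS]law; last by move=> i; case: ifP.
  rewrite [RHS]law //; congr (_ * (_)%:E)%E.
  rewrite big_ord_recr /= [X in _ * X](_ : _ = 1); last first.
    rewrite /extend leqnn ltnn eqxx ring_kernel_stable // mul1r.
    by rewrite total_rate_stable // mul0r oppr0 expR0.
  rewrite mulr1; apply: eq_bigr => i _.
  by rewrite /extend (ltnW (ltn_ord i)) (ltn_ord i) (ltn_eqF (ltn_ord i)).
have mF T : measurable (F T) by exact: measurable_cyl.
have mIF : measurable (\bigcap_T F T) by exact: bigcapT_measurable.
have IFE : Pr (\bigcap_T F T) = Pr (cyl0 k c).
  have : (Pr \o F) T @[T --> \oo] --> Pr (\bigcap_T F T).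
    apply: nonincreasing_cvg_mu => //; 
      first exact: (le_lt_trans (probability_le1 Pr (mF 0%N)) (ltry 1)).
    move=> m n mn; apply/subsetPset => w [wY wH]; split => // i ik.
    apply: le_lt_trans (wH i ik); rewrite lee_fin.
    by case: ifP => // _; rewrite ler_nat.
  rewrite (_ : Pr \o F = fun=> Pr (cyl0 k c)); last by apply/funext => T; exact: FE.
  by move/cvg_lim => <- //; rewrite lim_cst.
have mcQ : measurable (cyl0 k c `&` quiet_event x).
  by apply: measurableI; [exact: measurable_cyl|exact: measurable_quiet_event].
apply/eqP; rewrite eq_le; apply/andP; split; last first.
  by apply: le_measure; rewrite ?inE //; exact: measurable_cyl.
rewrite -IFE; apply: le_measure; rewrite ?inE //.
move=> w Fw.
have wY i : (i <= k)%N -> Y i w = c i.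
  move=> ik; have [/(_ i (leqW ik)) -> _] := Fw 0%N I.
  by rewrite /extend ik.
have wH i : (i < k)%N -> (0%:E < H i w)%E.
  move=> ik; have [_ /(_ i (leqW ik))] := Fw 0%N I.
  by rewrite (ltn_eqF ik).
split; first by split.
exists k; split => // [|i ik]; last by rewrite wY // cx.
apply/eqyP => A A0; pose T := (Num.truncn A).+1.
have [_ /(_ k (leqnn _))] := Fw T I; rewrite eqxx => /ltW; apply: le_trans.
by rewrite lee_fin ltW // truncnS_gt.
Qed.

(** Induction on the number [n] of rings left, for every history [c] up to [k]. Extending the
    history by each possible successor gives disjoint events whose probabilities add up through
    [sum_ring_kernel]; stable histories are settled by [cyl_stable]. *)
Lemma prob_quiet N x n k c : mass_le N (c k) ->
  (forall i, (i < k)%N -> ~~ active (c i) x) ->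
  fine (Pr (cyl0 k c)) * quiet lambda p x n (c k) <=
  fine (Pr (cyl0 k c `&` quiet_event x)).
Proof.
have mQ := measurable_quiet_event x.
elim: n k c => [|n IHn] k c ckN cx.
all: have [ax|ax] := boolP (active (c k) x);
  first by rewrite /= ax mulr0 fine_ge0.
all: have cx' i : (i <= k)%N -> ~~ active (c i) x
  by rewrite leq_eqVlt => /orP[/eqP ->//|/cx].
all: have [st|st] := boolP (stable (c k));
  first by rewrite -cyl_stable // ler_piMr ?fine_ge0 //; exact: quiet_le1 ckN.
  by rewrite /= (negbTE ax) (negbTE st) mulr0 fine_ge0.
have [s0 us0 s0P] := mass_le_active_seq ckN.
(* Inactive sites are discarded because the mass bound is known to survive topplings of active sites
   only. *)
pose s := [seq y <- s0 | active (c k) y].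
have us : uniq s by rewrite filter_uniq.
have sP y : active (c k) y -> y \in s by move=> ay; rewrite mem_filter ay s0P.
have sa : {subset s <= active (c k)} by move=> y; rewrite mem_filter => /andP[].
rewrite [quiet _ _ _ _ _]/= (negbTE ax) (negbTE st).
rewrite -(sum_ring_kernel _ _ _ ckN st us sP) // mulr_sumr.
pose F eta := cyl0 k.+1 (extend c k eta) `&` quiet_event x.
apply: (@le_trans _ _ (\sum_(eta <- successors s (c k)) fine (Pr (F eta)))).
  rewrite big_seq [leRHS]big_seq; apply: ler_sum => eta etaS.
  have ek : extend c k eta k.+1 = eta by rewrite /extend ltnn.
  have := IHn k.+1 (extend c k eta); rewrite ek fine_cyl0 prod_extend mulrA.
  rewrite [X in nu X](_ : _ = [set eta | restrict_config V eta = c 0%N]) //.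
  rewrite -fine_cyl0 -mulrA; apply.
    exact: mass_le_successors ckN sa etaS.
  by move=> i ik; rewrite /extend -ltnS ik cx'.
apply: sum_prob_le => //.
- by rewrite undup_uniq.
- by apply: measurableI; [exact: measurable_cyl|exact: mQ].
- by move=> eta; apply: measurableI; [exact: measurable_cyl|exact: mQ].
- move=> eta _ w [[wY wH] wQ]; split => //; split => i ik.
    by rewrite wY ?leqW // /extend ik.
  by apply: wH; exact: leqW.
- move=> eta eta' /eqP ee; apply/seteqP; split => // w [[[wY _] _] [[wY' _] _]].
  by move: (wY k.+1 (leqnn _)) (wY' k.+1 (leqnn _)) => ->; rewrite /extend ltnn => /ee.
Qed.

Lemma prob_quiet_event N x n (L : seq (config d)) : uniq L ->
  (forall c, c \in L -> mass_le N c) ->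
  \sum_(c <- L) fine (nu [set eta | restrict_config V eta = c]) *
    quiet lambda p x n c <= fine (Pr (quiet_event x)).
Proof.
move=> uL LN; have mQ := measurable_quiet_event x.
apply: (@le_trans _ _
  (\sum_(c <- L) fine (Pr (cyl0 0 (fun=> c) `&` quiet_event x)))).
  rewrite big_seq [leRHS]big_seq; apply: ler_sum => c cL.
  have := @prob_quiet N x n 0 (fun=> c) (LN c cL).
  by rewrite fine_cyl0 big_ord0 mulr1; apply.
apply: sum_prob_le => //.
- by move=> c; apply: measurableI; [exact: measurable_cyl|exact: mQ].
- move=> c c' /eqP ee; apply/seteqP; split => // w [[[wY _] _] [[wY' _] _]].
  by apply: ee; rewrite -(wY 0%N) // (wY' 0%N).
Qed.

(** Since [H m w] is infinite, there is a least index at which the accumulated holding times exceed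
    [t], and it is at most [m]. *)
Lemma quiet_event_visited x w (t : R) : 0 <= t -> quiet_event x w ->
  exists2 n, ~~ active (Y n w) x &
    ((\sum_(i < n) H i w <= t%:E) /\ (t%:E < \sum_(i < n.+1) H i w))%E.
Proof.
move=> t0 [m [Hpos Hm Yx]].
have exm : exists j, (t%:E < \sum_(i < j.+1) H i w)%E.
  (* The earlier sum must not be -oo, which would absorb +oo; it is nonnegative. *)
  exists m; rewrite big_ord_recr /= Hm addey ?ltry //.
  rewrite gt_eqF // (@lt_le_trans _ _ 0%E) ?ltNy0 //.
  by apply: sume_ge0 => i _; exact/ltW/Hpos.
have jm := ex_minnP exm.
case: jm => j tj jmin; exists j.
  apply: Yx; apply: jmin.
  rewrite big_ord_recr /= Hm addey ?ltry //.
  rewrite gt_eqF // (@lt_le_trans _ _ 0%E) ?ltNy0 //.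
  by apply: sume_ge0 => i _; exact/ltW/Hpos.
split => //; case: j jmin {tj} => [|j] jmin; first by rewrite big_ord0 lee_fin.
by rewrite leNgt; apply/negP => /jmin; rewrite ltnn.
Qed.

End HoldingTimes.

(** * Activity of a site in the path space *)

Section Visited.
Context {R : realType} {d : nat}.

(* Rational times suffice because trajectories are right-continuous. *)
Definition visited (x : site d) (t : R) : set (paths R d) :=
  [set w | exists r : rat,
     0 <= (ratr r : R) <= t /\ (0 < occ_active (w (ratr r : R) x))%N].

Lemma window_event_visited x t : window_event [fset x]%fset t (visited x t).
Proof.
rewrite /window_event; set Cyl := (X in <<s X >> _).
(* The window sigma-algebra is taken as a measurable space of its own, so that the closure lemmas
   for countable quantifiers apply. *)
change (measurable (visited x t : set (g_sigma_algebraType Cyl))).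
apply: (@measurable_exists _ (g_sigma_algebraType Cyl)) => r.
apply: measurable_and_const => rt.
rewrite (_ : mkset _ = [set w : g_sigma_algebraType Cyl |
    exists n, (w : trajectory R d) (ratr r) x = Active n.+1]); last first.
  by apply/seteqP; split => w /= /occ_activeP.
apply: measurable_exists => n; apply: sub_sigma_algebra.
by exists (ratr r), x, (Active n.+1); split => //; rewrite inE.
Qed.

Lemma measurable_visited x t : measurable (visited x t).
Proof.
have := @window_event_visited x t.
apply: sub_sigma_algebra2 => C [s [y [a [/andP[s0 _] _ ->]]]].
by exists s, y, a.
Qed.

Lemma subset_visited x (s t : R) : s <= t -> visited x s `<=` visited x t.
Proof.
move=> st w [r [/andP[r0 rs] ar]]; exists r; split => //.
by rewrite r0 (le_trans rs).
Qed.

Lemma active_rational (w : paths R d) (x : site d) (s : R) :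
  0 <= s -> (0 < occ_active (w s x))%N ->
  exists r : rat, s <= (ratr r : R) /\ (0 < occ_active (w (ratr r : R) x))%N.
Proof.
move=> s0 ax; have [/(_ s s0)] := trajectory_cadlag w x.
move=> [e /= e0 eP] _.
have se : s < s + e by rewrite ltrDl.
have [r] := rat_in_itvoo se; rewrite in_itv /= => /andP[sr re].
exists r; split; first exact: ltW.
rewrite (eP (ratr r)) //=.
by rewrite distrC ger0_norm ?subr_ge0 ?(ltW sr) // ltrBlDl.
Qed.

Lemma stays_active_visited x :
  stays_active `<=` \bigcup_n visited x n%:R.
Proof.
move=> w /(_ x 0)[s [s0 _ as_]].
have [r [sr ar]] := @active_rational w x s s0 as_.
exists (Num.truncn (ratr r : R)).+1 => //; exists r; split => //.
by rewrite (le_trans s0 sr) ltW // truncnS_gt.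
Qed.

Lemma measurable_stays_active : measurable (@stays_active R d).
Proof.
rewrite (_ : stays_active = [set w : paths R d | forall (x : site d) (n : nat),
  exists r : rat, n%:R <= (ratr r : R) /\ (0 < occ_active (w (ratr r : R) x))%N]).
  apply: measurable_forall => x; apply: measurable_forall => n.
  apply: measurable_exists => r; apply: measurable_and_const => nr.
  rewrite (_ : mkset _ = [set w : paths R d |
      exists n, (w : trajectory R d) (ratr r) x = Active n.+1]); last first.
    by apply/seteqP; split => w /= /occ_activeP.
  apply: measurable_exists => m; apply: sub_sigma_algebra.
  by exists (ratr r), x, (Active m.+1); split => //; exact: le_trans nr.
apply/seteqP; split => [w sw x n|w sw x T].
  have [s [s0 ns as_]] := sw x n%:R.
  have [r [sr ar]] := @active_rational w x s s0 as_.
  by exists r; split => //; exact: le_trans sr.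
have [r [nr ar]] := sw x (Num.truncn T).+1.
exists (ratr r); split => //; first exact: le_trans nr.
by apply: le_trans nr; rewrite ltW // truncnS_gt.
Qed.

(** On [quiet_event] the path shows no activity at [x] at any time, whence a bound that does not
    depend on [t]. *)
Lemma prob_visited_le (lambda : R) (p : site d -> R)
    (nu : probability (config d) R) V (Q : probability (paths R d) R) N x t n
    (L : seq (config d)) :
  0 < lambda -> jump_distribution p -> finite_system_law lambda p nu V Q ->
  uniq L -> (forall c, c \in L -> mass_le N c) ->
  fine (Q (visited x t)) <=
  1 - \sum_(c <- L) fine (nu [set eta | restrict_config V eta = c]) *
        quiet lambda p x n c.
Proof.
move=> lambda_gt0 p_jump [disp [Om [Pr [Y [H [X [[mY [mH mX]] law XY QX]]]]]]] uL LN.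
have mV := measurable_visited x t.
have mQ := measurable_quiet_event mY mH x.
have mXV : measurable (X @^-1` visited x t).
  by rewrite -[X in measurable X]setTI; exact: mX.
have le1 : (Pr (X @^-1` visited x t) <= Pr (~` quiet_event Y H x))%E.
  apply: le_measure; rewrite ?inE //; first exact: measurableC.
  move=> w [r [/andP[r0 _] ar]] /(quiet_event_visited r0)[m /negP am [m1 m2]].
  by apply: am; move: ar; rewrite (XY w m).
have := prob_quiet_event lambda_gt0 p_jump mY mH law x n uL LN.
rewrite -(lerN2 (fine _)) -(lerD2l 1); apply: le_trans.
have -> : 1 - fine (Pr (quiet_event Y H x)) = fine (Pr (~` quiet_event Y H x)).
  by rewrite probability_setC // fineB ?fin_num_measure.
by rewrite QX // fine_le ?fin_num_measure //; exact: measurableC.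
Qed.

End Visited.

(** * Uniform laws on finite families and sums over a period *)

Section Empirical.
Context {disp : measure_display} {T : measurableType disp} (R : realType).
Context (f : nat -> T) (n : nat).

Definition empirical : set T -> \bar R :=
  mscale (n.+1%:R^-1)%:nng (msum (fun i => \d_(f i)) n.+1).

HB.instance Definition _ := Measure.on empirical.

Lemma empiricalE (A : set T) :
  empirical A = (n.+1%:R^-1 * \sum_(i < n.+1) (f i \in A)%:R)%:E.
Proof. by rewrite /empirical /mscale /msum /= EFinM -sumEFin. Qed.

Let empirical_setT : empirical setT = 1%E.
Proof.
rewrite empiricalE (eq_bigr (fun=> 1)) => [|i _]; last by rewrite in_setT.
by rewrite sumr_const card_ord -[X in _ * X]/(n.+1%:R) mulVf.
Qed.

HB.instance Definition _ :=
  Measure_isProbability.Build _ _ _ empirical empirical_setT.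

Lemma integral_empirical (g : T -> \bar R) : measurable_fun setT g ->
  (forall t, 0 <= g t)%E ->
  (\int[empirical]_x g x = (n.+1%:R^-1)%:E * \sum_(i < n.+1) g (f i))%E.
Proof.
move=> mg g0; rewrite ge0_integral_mscale // ge0_integral_measure_sum //.
congr (_ * _)%E; apply: eq_bigr => i _.
by rewrite integral_dirac // diracT mul1e.
Qed.

End Empirical.

(** Moving the window by one drops its first term and adds a new last one; these agree by
    periodicity. Induction in both directions does the rest. *)
Lemma sum_periodic (V : zmodType) (h : int -> V) (q : nat) (z : int) :
  (forall j, h (j + q%:Z) = h j) ->
  \sum_(j < q) h (j%:Z + z) = \sum_(j < q) h j%:Z.
Proof.
move=> hq; pose S z := \sum_(j < q) h (j%:Z + z).
have S1 u : S (u + 1) = S u.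
  have := erefl (\sum_(i < q.+1) h ((i : nat)%:Z + u)).
  rewrite {1}big_ord_recl big_ord_recr /= [q%:Z + u]addrC hq add0r [RHS]addrC.
  move=> /addrI e; rewrite /S -e.
  by apply: eq_bigr => j _; congr h; rewrite /bump /=; lia.
have <- : S 0 = \sum_(j < q) h j%:Z by apply: eq_bigr => j _; rewrite addr0.
rewrite -/(S z) -/(S 0); elim/int_rect: z => [//|n IHn|n IHn].
  by rewrite -IHn -(S1 n%:Z); congr S; lia.
by rewrite -IHn -(S1 (- n.+1%:Z)); congr S; lia.
Qed.

(** * Periodic stripes with a uniform random phase *)

Section Stripes.
Context {d : nat} (i0 : 'I_d) (q k : nat).

(** For k <= q + 1, out of every q + 1 consecutive hyperplanes orthogonal to direction [i0], [k]
    carry one active particle per site; [j] is the phase. *)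
Definition stripes (j : int) : config d :=
  fun x => Active (modz (x 0 i0 + j) q.+1%:Z < k%:Z)%R.

Lemma shift_stripes z j : Defs.shift z (stripes j) = stripes (j + z 0 i0).
Proof.
apply/funext => x; rewrite /Defs.shift /stripes mxE.
by rewrite -addrA [z 0 i0 + j]addrC.
Qed.

Lemma stripes_periodic j : stripes (j + q.+1%:Z) = stripes j.
Proof. by apply/funext => x; rewrite /stripes addrA modzDr. Qed.

Lemma sum_stripes (V : zmodType) (g : config d -> V) (z : int) :
  \sum_(j < q.+1) g (stripes (j%:Z + z)) = \sum_(j < q.+1) g (stripes j%:Z).
Proof.
by apply: (sum_periodic (h := g \o stripes)) => j; rewrite /= stripes_periodic.
Qed.

Lemma sum_occ_stripes (V : pzRingType) x : (k <= q.+1)%N ->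
  \sum_(j < q.+1) (occ_abs (stripes j%:Z x))%:R = k%:R :> V.
Proof.
move=> kq; rewrite -(sum_stripes (fun e => (occ_abs (e x))%:R) (- x 0 i0)).
rewrite (eq_bigr (fun j : 'I_q.+1 => if (j < k)%N then 1 else 0)) => [|j _].
  by rewrite -big_mkcond -(big_ord_widen _ (fun=> 1)) // sumr_const card_ord.
rewrite /stripes /= addrCA subrr addr0 modz_small; last first.
  by rewrite lez_nat /= ltz_nat ltn_ord.
by rewrite ltz_nat; case: ltnP.
Qed.

Lemma stripes_shift0 (j : nat) :
  stripes j%:Z = Defs.shift (unit_site i0 *+ j) (stripes 0).
Proof.
by rewrite shift_stripes add0r mulmxnE mxE !eqxx /= ?mulr1n -[RHS]/(stripes (j%:R)) natz.
Qed.

Definition stripes_law (R : realType) : probability (config d) R :=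
  empirical R (fun j => stripes j%:Z) q.

Section Law.
Context {R : realType}.
Local Notation nu := (stripes_law R).

Lemma stripes_lawE (A : set (config d)) :
  nu A = (q.+1%:R^-1 * \sum_(j < q.+1) (stripes j%:Z \in A)%:R)%:E.
Proof. exact: empiricalE. Qed.

(** Translations rotate the phases, which preserves the uniform law. Every phase is a translate of
    phase 0, so an invariant event contains all of them or none. *)
Lemma stripes_law_ergodic : translation_ergodic nu.
Proof.
split => [z A mA|A mA invA].
  rewrite !stripes_lawE; congr (_ * _)%:E.
  rewrite -(sum_stripes (fun e => (e \in A)%:R) (z 0 i0)).
  by apply: eq_bigr => j _; rewrite -shift_stripes; congr (_%:R); rewrite !inE.
have inA (j : nat) : (stripes j%:Z \in A) = (stripes 0 \in A).
  rewrite stripes_shift0 -[in RHS](invA (unit_site i0 *+ j)).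
  by apply/idP/idP; rewrite !inE.
rewrite stripes_lawE (eq_bigr (fun=> (stripes 0 \in A)%:R)) => [|j _]; last first.
  by rewrite inA.
rewrite sumr_const card_ord; case: (_ \in A); [right|left].
  by rewrite -[X in _ * X]/(q.+1%:R) mulVf.
by rewrite mul0rn mulr0.
Qed.

Lemma stripes_law_active : all_active nu.
Proof.
rewrite /all_active stripes_lawE (eq_bigr (fun=> 1)) => [|j _].
  by rewrite sumr_const card_ord -[X in _ * X]/(q.+1%:R) mulVf.
by rewrite mem_set.
Qed.

Lemma measurable_config_pred (x : site d) (P : occ -> Prop) :
  measurable [set eta : config d | P (eta x)].
Proof.
rewrite (_ : mkset _ = [set eta : config d |
    exists n, P (Active n) /\ eta x = Active n]
   `|` [set eta | P Sleeping /\ eta x = Sleeping]).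
  apply: measurableU; first (apply: measurable_exists => n);
    by apply: measurable_and_const => _; exact: measurable_config_at.
apply/seteqP; split => eta /=; last by case=> [[n []]|[]] ? ->.
case E : (eta x) => [n|] Px; [left; exists n|right]; by [].
Qed.

Lemma stripes_law_density : (k <= q.+1)%N -> density nu = (k%:R / q.+1%:R)%:E.
Proof.
move=> kq; rewrite /density integral_empirical; last 2 first.
- move=> _ B mB; rewrite setTI.
  exact: (measurable_config_pred 0 (fun a => B ((occ_abs a)%:R)%:E)).
- by move=> e; rewrite lee_fin.
by rewrite sumEFin sum_occ_stripes // -EFinM mulrC.
Qed.

(** Phases may coincide on [V]; [nu] gives each distinct restriction the total weight of its
    phases. *)
Lemma sum_stripes_law (V : {fset site d}) (g : config d -> R) :
  \sum_(c <- undup [seq restrict_config V (stripes j%:Z) | j <- iota 0 q.+1])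
     fine (nu [set eta | restrict_config V eta = c]) * g c =
  q.+1%:R^-1 * \sum_(j < q.+1) g (restrict_config V (stripes j%:Z)).
Proof.
under eq_bigr do rewrite stripes_lawE /= -mulrA mulr_suml.
rewrite -mulr_sumr exchange_big /=; congr (_ * _); apply: eq_bigr => j _.
set c := restrict_config V (stripes j%:Z).
have cL : c \in undup [seq restrict_config V (stripes j%:Z) | j <- iota 0 q.+1].
  rewrite mem_undup (map_f (fun j : nat => restrict_config V (stripes j%:Z))) //.
  by rewrite mem_iota add0n ltn_ord.
rewrite (bigD1_seq _ cL) ?undup_uniq //= mem_set // mul1r big1 ?addr0 // => c' c'c.
rewrite memNset ?mul0r // => e; move/eqP: c'c; apply.
by rewrite -e.
Qed.

End Law.
End Stripes.

(** * Cubes and their Folner property *)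

Definition box (d M : nat) (a : int) : seq (site d) :=
  [seq \row_i ((f i : nat)%:Z + a) |
    f : {ffun 'I_d -> 'I_M} <- enum {ffun 'I_d -> 'I_M}].

Lemma mem_box d M a (x : site d) :
  reflect (forall i, a <= x 0 i < a + M%:Z) (x \in box d M a).
Proof.
apply: (iffP mapP) => [[f _ ->] i|xP].
  by rewrite mxE lerDr [a + _]addrC ltrD2r ltz_nat ltn_ord.
have xM i : (absz (x 0%R i - a)%R < M)%N by have := xP i; lia.
exists [ffun i => Ordinal (xM i)]; first by rewrite mem_enum.
apply/matrixP => u i; rewrite mxE ffunE ord1 /=.
by have := xP i; lia.
Qed.

Lemma box_uniq d M a : uniq (box d M a).
Proof.
rewrite map_inj_uniq ?enum_uniq // => f g /matrixP fg.
apply/ffunP => i; have := fg 0 i; rewrite !mxE => /addIr [e].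
exact: val_inj.
Qed.

Lemma size_box d M a : size (box d M a) = (M ^ d)%N.
Proof. by rewrite size_map -cardE card_ffun !card_ord. Qed.

Lemma exp1D_le (R : realFieldType) (n : nat) (e : R) : 0 < e ->
  exists2 h : R, 0 < h & forall x, 0 <= x <= h -> (1 + x) ^+ n <= 1 + e.
Proof.
elim: n e => [|n IHn] e e0.
  by exists 1 => // x _; rewrite expr0 lerDl ltW.
(* For m <= 1, (1 + m)^2 <= 1 + 3m, hence the third of [e]. *)
have e2 : 0 < Num.min 1 (e / 3) by rewrite lt_min ltr01 divr_gt0.
have [h h0 hP] := IHn _ e2.
exists (Num.min h (Num.min 1 (e / 3))) => [|x].
  by rewrite lt_min h0.
rewrite !le_min => /andP[x0 /andP[xh /andP[x1 xe]]].
have := hP x; rewrite x0 xh => /(_ isT) le1.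
rewrite exprSr (le_trans (ler_wpM2r _ le1)) ?addr_ge0 //.
have : Num.min 1 (e / 3) <= 1 by rewrite ge_min lexx.
have : Num.min 1 (e / 3) <= e / 3 by rewrite ge_min lexx orbT.
move: (Num.min _ _) e2 => m m0 me m1.
nra.
Qed.

(** [W] is a cube of side [M] and [V] its enlargement by [r] on every side, where [r] bounds the
    coordinates in [V0]; the volume ratio (1 + 2r/M)^d tends to 1. *)
Lemma folner (R : realType) d (V0 : {fset site d}) (e : R) : 0 < e ->
  exists (V : {fset site d}) (W : seq (site d)),
  [/\ uniq W, W != [::],
      forall v y, v \in V0 -> y \in W -> v + y \in V
    & #|` V|%:R <= (1 + e) * (size W)%:R].
Proof.
move=> e0; have [h h0 hP] := exp1D_le d e0.
pose r := (\sum_(v <- V0) \sum_(i < d) absz (v 0%R i))%N.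
have rP v i : v \in V0 -> (absz (v 0%R i) <= r)%N.
  move=> vV; rewrite /r (bigD1_seq v) ?fset_uniq //= (bigD1 i) //=.
  by rewrite -addnA leq_addr.
(* This side length makes 2r/M at most [h]. *)
pose M := (Num.truncn ((2 * r)%:R / h)).+1.
have M0 : (0 : R) < M%:R by rewrite ltr0n.
exists [fset x in box d (M + 2 * r) (- r%:Z)]%fset, (box d M 0); split.
- exact: box_uniq.
- by rewrite -size_eq0 size_box expn_eq0.
- move=> v y vV /mem_box yW; rewrite in_fset; apply/mem_box => i.
  move: (yW i) (rP v i vV); rewrite mxE; move: (v 0 i) (y 0 i) => a b; lia.
rewrite size_box.
apply: (@le_trans _ _ ((M + 2 * r) ^ d)%:R).
  by rewrite ler_nat -(size_box d _ (- r%:Z)) card_fseq size_undup.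
rewrite !natrX natrD -{1}[M%:R]mul1r -[(2 * r)%:R](divfK (lt0r_neq0 M0)) -mulrDl.
rewrite exprMn ler_pM2r ?exprn_gt0 //; apply: hP.
rewrite divr_ge0 //= ler_pdivrMr // mulrC -ler_pdivrMr // ltW // truncnS_gt //.
Qed.

Lemma sum_const_seq (V : nmodType) (T : Type) (s : seq T) (a : V) :
  \sum_(x <- s) a = a *+ size s.
Proof. by rewrite big_const_seq count_predT iter_addr_0. Qed.

Lemma mass_le_restrict d (V : {fset site d}) (eta : config d) :
  mass_le (\sum_(x <- V) occ_abs (eta x)) (restrict_config V eta).
Proof.
move=> W uW.
apply: (@leq_trans (\sum_(x <- [seq x <- W | x \in V]) occ_abs (eta x))).
  rewrite big_filter [leqRHS]big_mkcond; apply: leq_sum => x _.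
  by rewrite /restrict_config; case: (x \in V).
apply: (@leq_sum_sub _ (fun x => occ_abs (eta x))).
- by rewrite filter_uniq.
- exact: fset_uniq.
- by move=> x; rewrite mem_filter => /andP[].
Qed.

Lemma mass_le_trans d (M N : nat) (eta : config d) :
  (M <= N)%N -> mass_le M eta -> mass_le N eta.
Proof. by move=> MN etaM W uW; apply: leq_trans (etaM W uW) MN. Qed.

Lemma jump_direction (R : realType) d (p : site d -> R) : jump_distribution p ->
  exists2 e, e \in neighbours d & 0 < p e.
Proof.
move=> pj; apply: contrapT => no; have [p0 _ _ _] := pj.
have := oner_neq0 R; rewrite -(sum_neighbours pj) big_seq big1 ?eqxx // => z zn.
by apply/eqP; rewrite eq_le p0 andbT leNgt; apply/negP => pz; apply: no; exists z.
Qed.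

(** * The bound in finite volume, in arbitrarily large windows *)

Section Final.
Context {R : realType} {d : nat} (i0 : 'I_d) (q k : nat).
Context (lambda : R) (p : site d -> R).
Context (kq : (k <= q.+1)%N).
Context (lambda_gt0 : 0 < lambda) (p_jump : jump_distribution p).
Local Notation nu := (stripes_law i0 q k R).
Local Notation theta := (lambda / (1 + lambda)).
Local Notation st j := (stripes i0 q k j).

Let theta_gt0 : 0 < theta.
Proof. by rewrite divr_gt0 // addr_gt0. Qed.

Lemma unvisited_window (V0 : {fset site d}) (e : R) : 0 < e ->
  exists2 V : {fset site d}, (V0 `<=` V)%fset &
  forall Q : probability (paths R d) R, finite_system_law lambda p nu V Q ->
  forall t, fine (Q (visited 0 t)) <=
    (1 + e) * (k%:R / q.+1%:R / theta) + e.
Proof.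
move=> e0; have [V1 [W [uW W0 V0W V1W]]] := folner V0 e0.
have [u un pu] := jump_direction p_jump.
have [n Gn] := stab1_cvg lambda_gt0 p_jump un pu #|` V1| e0.
pose F y c := stabilize lambda p n (fun e => (occupied y e)%:R) c.
pose S y := \sum_(j < q.+1) F y (restrict_config V1 (st j%:Z)).
have SW : \sum_(y <- W) S y <= k%:R * #|` V1|%:R.
  rewrite /S exchange_big /=.
  apply: (@le_trans _ _ (\sum_(j < q.+1)
      (\sum_(x <- V1) occ_abs (st j%:Z x))%:R)).
    apply: ler_sum => j _.
    apply: (sum_stabilize_occupied lambda_gt0 p_jump n uW).
    exact: mass_le_restrict.
  under eq_bigr do rewrite natr_sum.
  rewrite exchange_big /= (eq_bigr (fun=> k%:R)) => [|x _].
    by rewrite sum_const_seq -[leLHS]mulr_natr.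
  exact: sum_occ_stripes.
have [y yW Sy] : exists2 y, y \in W & S y <= k%:R * (1 + e).
  apply: contrapT => no.
  have lt y : y \in W -> k%:R * (1 + e) < S y.
    by move=> yW; rewrite ltNge; apply/negP => ?; apply: no; exists y.
  have : k%:R * (1 + e) * (size W)%:R < \sum_(y <- W) S y.
    rewrite mulr_natr -sum_const_seq -subr_gt0 -sumrB.
    case: (W) W0 lt => // y W' _ lt; rewrite big_cons ltr_pwDl //.
      by rewrite subr_gt0 lt ?mem_head.
    rewrite big_seq; apply: sumr_ge0 => z zW.
    by rewrite subr_ge0 ltW // lt // in_cons zW orbT.
  rewrite ltNge => /negP; apply; apply: le_trans SW _.
  by rewrite -mulrA ler_wpM2l.
pose V := [fset x - y | x in V1]%fset.
have inV x : (x \in V) = (x + y \in V1).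
  apply/imfsetP/idP => [[z /= zV ->]|xV]; first by rewrite subrK.
  by exists (x + y); rewrite ?addrK.
exists V; first by apply/fsubsetP => v vV; rewrite inV V0W.
move=> Q Qlaw t; set L := undup [seq restrict_config V (st j%:Z) | j <- iota 0 q.+1].
have LN j : mass_le #|` V1| (restrict_config V (st j%:Z)).
  apply: mass_le_trans (mass_le_restrict _ _).
  apply: (@leq_trans #|` V|); last exact: leq_imfset_card.
  rewrite -sum1_size; apply: leq_sum => x _.
  by rewrite /stripes /=; case: (_ < _)%R.
have := @prob_visited_le _ _ _ _ _ _ _ #|` V1| 0 t n L lambda_gt0 p_jump Qlaw.
rewrite undup_uniq => /(_ isT) Qle.
apply: le_trans (Qle _) _.
  by move=> c; rewrite mem_undup => /mapP[j _ ->].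
rewrite sum_stripes_law.
rewrite [leLHS](_ : _ = q.+1%:R^-1 * \sum_(j < q.+1)
    (1 - quiet lambda p 0 n (restrict_config V (st j%:Z)))); last first.
  by rewrite sumrB mulrBr sumr_const card_ord mulVf.
have FV (j : nat) : F 0 (restrict_config V (st j%:Z)) =
    F y (restrict_config V1 (st (j%:Z + (- y) 0 i0))).
  rewrite -shift_stripes /F.
  have -> : restrict_config V (st j%:Z) =
      Defs.shift y (restrict_config V1 (Defs.shift (- y) (st j%:Z))).
    apply/funext => x; rewrite /Defs.shift /restrict_config inV.
    by rewrite addrK.
  rewrite stabilize_shift; congr (stabilize _ _ _ _ _); apply/funext => c.
  by rewrite /occupied /Defs.shift add0r.
have le1 (j : 'I_q.+1) : 1 - quiet lambda p 0 n (restrict_config V (st j%:Z)) <=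
    F y (restrict_config V1 (st (j%:Z + (- y) 0 i0))) / theta + e.
  have := visited_le lambda_gt0 p_jump 0 n (LN j).
  rewrite -/(F 0 _) FV mulrC -ler_pdivlMr // => vle.
  have := Gn _ (LN j); rewrite lerBlDr => Gle.
  rewrite lerBlDr; apply: le_trans Gle _.
  by rewrite addrAC lerD2r -lerBlDr.
apply: (@le_trans _ _ (q.+1%:R^-1 * (S y / theta + e *+ q.+1))).
  rewrite ler_wpM2l // (le_trans (ler_sum _ (fun j _ => le1 j))) //.
  rewrite big_split /= -mulr_suml sumr_const card_ord.
  by rewrite (sum_stripes i0 q k (fun c => F y (restrict_config V1 c))).
rewrite -[e *+ _]mulr_natl mulrDr [X in _ + X]mulrA mulVf // mul1r lerD2r.
rewrite [leRHS](_ : _ = q.+1%:R^-1 * (k%:R * (1 + e) / theta)); last first.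
  by move: theta^-1 q.+1%:R^-1 => a b; ring.
by rewrite ler_wpM2l // ler_pM2r ?invr_gt0.
Qed.
End Final.

Lemma fraction_between (R : realType) (a b : R) : 0 <= a -> a < b ->
  exists q k : nat, a < k%:R / q.+1%:R < b.
Proof.
move=> a0 ab; have ba0 : 0 < b - a by rewrite subr_gt0.
pose q := Num.truncn (b - a)^-1; pose k := (Num.truncn (a * q.+1%:R)).+1.
have q0 : (0 : R) < q.+1%:R by rewrite ltr0n.
exists q, k; rewrite ltr_pdivlMr // truncnS_gt ltr_pdivrMr //=.
have ka : k%:R <= a * q.+1%:R + 1.
  by rewrite /k -natr1 lerD2r truncn_le // mulr_ge0.
apply: le_lt_trans ka _; rewrite -ltrBrDl -mulrBl -ltr_pdivrMl // mulr1.
exact: truncnS_gt.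
Qed.

Lemma stays_active_lt1 (R : realType) (d : nat) (i0 : 'I_d) (q k : nat)
    (lambda : R) (p : site d -> R) (P : probability (paths R d) R) :
  0 < lambda -> jump_distribution p ->
  k%:R / q.+1%:R < lambda / (1 + lambda) ->
  ARW_law lambda p (stripes_law i0 q k R) P ->
  (P stays_active < 1)%E.
Proof.
move=> lambda_gt0 p_jump; set theta := lambda / _; set rho := _ / _.
move=> rt [Q Qlaw Qlim].
have q0 : (0 : R) < q.+1%:R by rewrite ltr0n.
have theta_gt0 : 0 < theta by rewrite divr_gt0 // addr_gt0.
have theta_lt1 : theta < 1.
  by rewrite /theta ltr_pdivrMr ?addr_gt0 // mul1r ltrDr.
have kq : (k <= q.+1)%N.
  by rewrite -(ler_nat R) -[leRHS]mul1r -ler_pdivrMr // ltW // (lt_trans rt).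
have a1 : rho / theta < 1 by rewrite ltr_pdivrMr // mul1r.
pose e := (1 - rho / theta) / 4.
have e0 : 0 < e by rewrite divr_gt0 // subr_gt0.
pose c := (1 + e) * (rho / theta) + e.
have c1 : c < 1.
  rewrite /c; have -> : rho / theta = 1 - 4 * e.
    by rewrite /e [4 * _]mulrC divfK ?pnatr_eq0 // subKr.
  move: e0; move: (e) => x x0; nra.
have Pc t : (P (visited 0%R t) <= c%:E)%E.
  rewrite leNgt; apply/negP => cP.
  have := Qlim [fset 0%R]%fset t _ (window_event_visited (x := 0%R) (t := t)).
  move=> /(_ _ (open_ereal_gt' cP)) [V0 _ V0P].
  have [V V0V Vle] := unvisited_window i0 kq lambda_gt0 p_jump V0 e0.
  have /= := V0P V V0V.
  rewrite -[X in (_ < X)%E]fineK ?fin_num_measure //; last exact: measurable_visited.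
  by rewrite lte_fin ltNge => /negP; apply; exact: Vle (Qlaw V) t.
have mV n : measurable (visited (0 : site d) n%:R : set (paths R d)).
  exact: measurable_visited.
have mU : measurable (\bigcup_n (visited (0 : site d) n%:R : set (paths R d))).
  exact: bigcupT_measurable.
apply: (@le_lt_trans _ _ c%:E); last by rewrite lte_fin.
apply: (@le_trans _ _ (P (\bigcup_n visited (0 : site d) n%:R))).
  apply: le_measure; rewrite ?inE //; first exact: measurable_stays_active.
  exact: stays_active_visited.
have cvgP : (P \o (fun n => visited (0 : site d) n%:R)) n @[n --> \oo] -->
    P (\bigcup_n visited (0 : site d) n%:R).
  apply: nondecreasing_cvg_mu => // m n mn; apply/subsetPset.
  by apply: subset_visited; rewrite ler_nat.
rewrite -(cvg_lim _ cvgP) //; apply: lime_le.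
  by apply/cvg_ex; eexists; exact: cvgP.
by apply: nearW => n; exact: Pc.
Qed.

Theorem theorem7p1 (R : realType) (d : nat) (d_ge1 : (1 <= d)%N)
  (lambda : R) (lambda_gt0 : 0 < lambda)
  (p : site d -> R) (p_jump : jump_distribution p)
  (P : probability (config d) R -> probability (paths R d) R)
  (P_law : forall nu : probability (config d) R,
     translation_ergodic nu -> (density nu < +oo)%E ->
     ARW_law lambda p nu (P nu))
  (zetac : R) (zetac_critical : critical_density P zetac) :
  lambda / (1 + lambda) <= zetac.
Proof.
rewrite leNgt; apply/negP => zt.
have theta_gt0 : 0 < lambda / (1 + lambda) by rewrite divr_gt0 // addr_gt0.
have theta_lt1 : lambda / (1 + lambda) < 1.
  by rewrite ltr_pdivrMr ?addr_gt0 // mul1r ltrDr.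
have [||q [k /andP[]]] := @fraction_between R (Num.max 0 zetac) (lambda / (1 + lambda)).
- by rewrite le_max lexx.
- by rewrite gt_max theta_gt0.
rewrite gt_max => /andP[_ zk] kt.
have q0 : (0 : R) < q.+1%:R by rewrite ltr0n.
have kq : (k <= q.+1)%N.
  by rewrite -(ler_nat R) -[leRHS]mul1r -ler_pdivrMr // ltW // (lt_trans kt).
pose i0 : 'I_d := Ordinal d_ge1.
have erg := stripes_law_ergodic i0 q k (R := R).
have dens := @stripes_law_density d i0 q k R kq.
have law : ARW_law lambda p (stripes_law i0 q k R) (P (stripes_law i0 q k R)).
  by apply: P_law => //; rewrite dens ltry.
have := stays_active_lt1 lambda_gt0 p_jump kt law.
by rewrite (zetac_critical _ _ erg (stripes_law_active i0 q k) dens).2 // ltxx.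
Qed.
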